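(* Let $X$ be a symmetric space on $[0,1]$ which is an interpolation space for the couple $(L_1,L_\infty)$ and suppose that the Kruglov operator $K$ acts boundedly on $X$. Then there exists a universal constant $\alpha>0$ such that for all $n\in\mathbb{N}$ and any sequence $\{f_k\}_{k=1}^n\subset X$ of independent random variables the following inequality holds: $$\tfrac15\bigl(\bigl\|F^*\chi_{[0,1]}\bigr\|_X+\|U_n\|_{L_1}\bigr)\le\|U_n\|_X\le\alpha\,\|K\|_{X\to X}\bigl(\bigl\|F^*\chi_{[0,1]}\bigr\|_X+\|U_n\|_{L_1}\bigr),$$ where $S_k=\sum_{i=1}^kf_i$, $U_n(t)=\max_{k=1,\dots,n}|S_k(t)|$ for $t\in[0,1]$, and $F$ is the disjointification of $\{f_k\}_{k=1}^n$.
   Context: $\lambda$ is Lebesgue measure; random variables are measurable functions on $([0,1],\lambda)$. For a measurable function $f$, $f^*$ denotes the decreasing rearrangement of $|f|$. A symmetric space $X$ on $[0,1]$ is a Banach space of measurable functions on $[0,1]$ such that $f\in X$ and $g^*\le f^*$ imply $g\in X$ and $\|g\|_X\le\|f\|_X$; always normalized by $\|\chi_{(0,1)}\|_X=1$. For a Banach couple $(X_0,X_1)$, a Banach space $X$ with $X_0\cap X_1\subseteq X\subseteq X_0+X_1$ is an interpolation space between $X_0$ and $X_1$ if every bounded linear operator $A:X_0+X_1\to X_0+X_1$ mapping $X_i$ boundedly into $X_i$ ($i=0,1$) also maps $X$ boundedly into $X$. Here $L_1=L_1[0,1]$, $L_\infty=L_\infty[0,1]$. The disjointification of $\{f_k\}_{k=1}^n$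 is $F(t)=\sum_{k=1}^nf_k(t-k+1)\chi_{[k-1,k]}(t)$, $t>0$. Kruglov operator: let $\{B_n\}_{n\ge1}$ be pairwise disjoint measurable subsets of $[0,1]$ with $\lambda(B_n)=\frac1{e\,n!}$, and let $(\Omega,\mathcal P)=\prod_{n=0}^\infty([0,1],\lambda_n)$ with each $\lambda_n$ Lebesgue measure on $[0,1]$. For $f\in L_1[0,1]$, $$Kf(\omega_0,\omega_1,\dots)=\sum_{n=1}^\infty\sum_{k=1}^n f(\omega_k)\chi_{B_n}(\omega_0).$$ $K$ is a positive linear operator $L_1[0,1]\to L_1(\Omega,\mathcal P)$. $\|Kf\|_X$ means $\|(Kf)^*\|_X$; $K$ acts boundedly on $X$ if $\|K\|_{X\to X}:=\sup_{\|f\|_X\le1}\|Kf\|_X<\infty$. *)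

(* Defs.v *)
From HB Require Import structures.
From mathcomp Require Import all_boot all_order all_algebra.
From mathcomp Require Import all_classical all_reals all_analysis.
Import Order.TTheory GRing.Theory Num.Theory.
Import numFieldNormedType.Exports.

Set Implicit Arguments.
Unset Strict Implicit.
Unset Printing Implicit Defensive.

Local Open Scope classical_set_scope.
Local Open Scope ring_scope.

(* The probability space ([0,1], lambda) is carried by the whole line, equipped
   with Lebesgue measure restricted to [0,1]: a measurable function on [0,1] is
   a Borel function R -> R whose values off [0,1] are immaterial. *)
Section unit_interval.
Context (R : realType).

Definition lambda01 : set (measurableTypeR R) -> \bar R :=
  mrestr (@lebesgue_measure R) (measurable_itv `[0, 1]).

HB.instance Definition _ := Measure.on lambda01.

Let lambda01_setT : lambda01 setT = 1%E.
Proof.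
by rewrite /lambda01 /mrestr setTI lebesgue_measure_itv/= lte01 sube0.
Qed.

HB.instance Definition _ := @Measure_isProbability.Build _ _ R
  lambda01 lambda01_setT.

End unit_interval.
Arguments lambda01 {R}.

(* Decreasing rearrangement of `|f| with respect to mu. Only its values at t > 0
   are meaningful: there, if f vanishes off a set of finite measure, the set
   below is nonempty; at t = 0 it may be empty (f unbounded), and inf set0 = 0. *)
Definition rearr d (T : measurableType d) (R : realType)
    (mu : {measure set T -> \bar R}) (f : T -> R) (t : R) : R :=
  inf [set s | 0 <= s /\ (mu [set x | (s < `|f x|)%R] <= t%:E)%E].

(* A space of measurable functions on [0,1] is given by the set of all
   representatives (modulo lambda01-a.e. equality) of its elements and by its
   norm, whose values off the space are irrelevant. *)
Record fspace (R : realType) := FSpace {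
  fs_mem :> (R -> R) -> Prop;
  fs_norm : (R -> R) -> R }.
Arguments fs_norm {R} X f : rename.

Section function_spaces.
Context (R : realType).
Implicit Types X Y : fspace R.

Record banach_fspace X : Prop := BanachFSpace {
  bfs_measurable : forall f, X f -> measurable_fun [set: R] f;
  bfs_ae : forall f g, X f -> measurable_fun [set: R] g ->
    {ae lambda01, forall x, f x = g x} -> X g;
  bfs_0 : X (cst 0);
  bfs_D : forall f g, X f -> X g -> X (f \+ g);
  bfs_Z : forall (a : R) f, X f -> X (a \*o f);
  bfs_norm_ge0 : forall f, X f -> 0 <= fs_norm X f;
  bfs_norm_eq0 : forall f, X f ->
    (fs_norm X f = 0 <-> {ae lambda01, forall x, f x = 0});
  bfs_normD : forall f g, X f -> X g ->
    fs_norm X (f \+ g) <= fs_norm X f + fs_norm X g;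
  bfs_normZ : forall (a : R) f, X f ->
    fs_norm X (a \*o f) = `|a| * fs_norm X f;
  bfs_complete : forall u : nat -> R -> R, (forall n, X (u n)) ->
    (forall e : R, 0 < e -> exists N, forall m n,
      (N <= m)%N -> (N <= n)%N -> fs_norm X (u m \- u n) < e) ->
    exists2 f, X f & (fun n => fs_norm X (u n \- f)) @ \oo --> (0 : R) }.

Record symmetric_space X : Prop := SymmetricSpace {
  ss_banach : banach_fspace X;
  ss_rearr : forall f g, X f -> measurable_fun [set: R] g ->
    (forall t, 0 < t -> rearr lambda01 g t <= rearr lambda01 f t) ->
    X g /\ fs_norm X g <= fs_norm X f;
  ss_indic : X \1_`]0, 1[%classic;
  ss_normalized : fs_norm X \1_`]0, 1[%classic = 1 }.

Definition Lp_fspace (p : \bar R) : fspace R :=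
  FSpace (fun f => measurable_fun [set: R] f /\ finite_norm lambda01 p f)
         (fun f => fine ('N[lambda01]_p[EFin \o f])%E).

Definition sum_fspace X Y : fspace R :=
  FSpace (fun f => exists g h, [/\ X g, Y h & f = g \+ h])
         (fun f => inf [set r | exists g h,
            [/\ X g, Y h, f = g \+ h & r = fs_norm X g + fs_norm Y h]]).

Definition bounded_on X (A : (R -> R) -> R -> R) : Prop :=
  exists C : R, forall f, X f -> X (A f) /\ fs_norm X (A f) <= C * fs_norm X f.

(* Linearity modulo a.e. equality. For A bounded on X, it makes A induce a
   linear operator on the quotient. *)
Definition linear_on X (A : (R -> R) -> R -> R) : Prop :=
  forall (a b : R) f g, X f -> X g ->
    {ae lambda01, forall x,
       A ((a \*o f) \+ (b \*o g)) x = a * A f x + b * A g x}.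

Definition interpolation_space X0 X1 X : Prop :=
  [/\ fs_mem X0 `&` fs_mem X1 `<=` fs_mem X,
      fs_mem X `<=` fs_mem (sum_fspace X0 X1) &
      forall A, linear_on (sum_fspace X0 X1) A ->
        bounded_on (sum_fspace X0 X1) A ->
        bounded_on X0 A -> bounded_on X1 A -> bounded_on X A].

End function_spaces.

Section independence.
Context d (T : measurableType d) (R : realType) (P : probability T R).

(* As A i may be setT, the product rule covers every subfamily. *)
Definition independent_rvs n (f : 'I_n -> T -> R) : Prop :=
  forall A : 'I_n -> set R, (forall i, measurable (A i)) ->
    P (\bigcap_i (f i @^-1` A i)) = (\prod_(i < n) P (f i @^-1` A i))%E.

End independence.

Section kruglov.
Context (R : realType).

Definition coordinate_events : set (set (nat -> R)) :=
  [set E | exists k (A : set R),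
     measurable A /\ E = [set w : nat -> R | A (w k)]].

(* R^nat with the product sigma-algebra. *)
Definition Omega := g_sigma_algebraType coordinate_events.

Definition is_product_measure (P : probability Omega R) : Prop :=
  forall n (A : nat -> set R), (forall k, measurable (A k)) ->
    P [set w : Omega | forall k, (k < n)%N -> A k (w k)] =
      (\prod_(k < n) lambda01 (A k))%E.

(* B n is used only for n >= 1. *)
Definition kruglov_partition (B : nat -> set R) : Prop :=
  [/\ forall n, (0 < n)%N -> measurable (B n) /\ B n `<=` `[0, 1],
      trivIset [set n | (0 < n)%N] B &
      forall n, (0 < n)%N ->
        lebesgue_measure (B n) = ((expR 1 * n`!%:R)^-1)%:E].

(* For each w at most one term of the series is nonzero. *)
Definition kruglov (B : nat -> set R) (f : R -> R) (w : Omega) : R :=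
  limn (fun N => \sum_(1 <= n < N)
    \sum_(1 <= k < n.+1) f (w k) * \1_(B n) (w 0)).

Context (P : probability Omega R) (B : nat -> set R) (X : fspace R).

Definition kruglov_rearr (f : R -> R) : R -> R := rearr P (kruglov B f).

Definition kruglov_norms : set R :=
  [set fs_norm X (kruglov_rearr f) | f in [set f | X f /\ fs_norm X f <= 1]].

Definition kruglov_bounded : Prop :=
  (forall f, X f -> X (kruglov_rearr f)) /\ has_ubound kruglov_norms.

Definition kruglov_opnorm : R := sup kruglov_norms.

End kruglov.

Section partial_sums.
Context (R : realType) (n : nat) (f : 'I_n -> R -> R).

(* Indices are shifted: f k stands for f_{k+1}, k < n. *)
Definition disjointification (t : R) : R :=
  \sum_(k < n) f k (t - k%:R) * \1_(`[k%:R, k%:R + 1]%classic : set R) t.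

Definition partial_sum (k : 'I_n) (t : R) : R :=
  \sum_(i < n | (i <= k)%N) f i t.

Definition max_partial_sum (t : R) : R :=
  \big[Num.max/0]_(k < n) `|partial_sum k t|.

(* F^* chi_[0,1], with F extended by 0 to the whole line. *)
Definition rearr_head (t : R) : R :=
  rearr (@lebesgue_measure R) disjointification t
    * \1_(`[0, 1]%classic : set R) t.

End partial_sums.

(* Main.v *)
Require Import Defs.
From HB Require Import structures.
From mathcomp Require Import all_boot all_order all_algebra.
From mathcomp Require Import all_classical all_reals all_analysis.
From mathcomp Require Import measurable_realfun ring lra.
Import Order.TTheory GRing.Theory Num.Theory.
Import numFieldNormedType.Exports.
Set Implicit Arguments.
Unset Strict Implicit.
Unset Printing Implicit Defensive.
Local Open Scope classical_set_scope.
Local Open Scope ring_scope.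

(** Write d_f(s) for the measure of the set where |f| > s, K for the Kruglov
    operator, U for the maximal partial sum and h for the head of the
    rearrangement of the disjointification. The norm of a symmetric space is
    monotone in d_f (ss_dom), and doubling d_f at most doubles the norm, by
    superposing a rearrangement and its mirror image (ss_double).

    Lower estimate. The distribution function of h is the minimum of 1 and of
    the sum of the d_(f_k). By independence the maximum of the |f_k| has
    distribution function 1 - prod (1 - d_(f_k)), which is at least half of
    that minimum, and it is at most 2 U: hence |h| <= 4 |U| in norm
    (rearr_head_le). The L1 norm is dominated by that of X (L1_le_ss), and
    4 + 1 = 5.

    Upper estimate. Truncate the f_k at the level s0 = h(1), above which the
    sum of the d_(f_k) is at most 1. Then U <= A + V, where A is the sum of
    the |f_k| exceeding s0 and V is the maximal function of the small parts.

    For A, integrate out one variable at a time: E G(A) is bounded by the sum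
    over m <= n of (T_1 + ... + T_n)^m G(0) / m!, where T_k is the convolution
    with the law of the large values of f_k (sum_large_le). Above s0 the laws
    of the |f_k| add up to the law of h, so that T_1 + ... + T_n is bounded by
    the convolution T with the law of h (total_jump_le_conv). For G the
    indicator of ]s, +oo[, the number T^m G(0) / (e m!) is the probability
    that the first coordinate lies in B_m and a sum of m copies of h exceeds
    s. Summing over m gives d_A <= e d_(K h) (kruglov_tail).

    For V, let D be at least the sum of the norm of h and the L1 norm of U.
    The small parts are bounded by D and V has mean at most D, since
    V <= U + A. So the centred partial sums S_k satisfy E |S_n| <= 2 D, which
    for bounded independent summands forces the variance to be O(D^2)
    (variance_bound). Chernoff's bound for the walk stopped on leaving an
    interval then gives P(max |S_k| > A0 j D) <= 1 / (e j!) for a universal A0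
    (maximal_tail). This is the measure of B_j, where K 1 = j, so V is
    dominated in distribution by D (1 + A0) + D A0 K 1 (dfun_small_max).

    Both bounds are multiples of D |K|, because |K 1| >= 1/4 allows constants
    to be absorbed (kruglov_opnorm_ge). *)

(** * Independence and Markov chains *)

Section pushforward_finite.
Context d d' (T : measurableType d) (T' : measurableType d') (R : realType).
Variables (mu : {finite_measure set T -> \bar R}) (X : {mfun T >-> T'}).

(** Carries the finite-measure instance in which uniqueness of product
    measures is stated. *)
Definition mpushforward : set T' -> \bar R := pushforward mu X.

Let pushforward0 : mpushforward set0 = 0%E.
Proof. by rewrite /mpushforward/pushforward preimage_set0 measure0. Qed.

Let pushforward_ge0 A : (0 <= mpushforward A)%E.
Proof. exact: measure_ge0. Qed.

Let pushforward_sigma_additive : semi_sigma_additive mpushforward.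
Proof.
have mX : measurable_fun setT X by exact: measurable_funP.
pose m : {measure set T' -> \bar R} :=
  measure_function_pushforward__canonical__measure_function_Measure mu mX.
exact: (@measure_semi_sigma_additive _ _ _ m).
Qed.

HB.instance Definition _ := isMeasure.Build _ _ _ mpushforward
  pushforward0 pushforward_ge0 pushforward_sigma_additive.

Let fin : fin_num_fun mpushforward.
Proof.
move=> A mA; apply: fin_num_measure.
by rewrite -[X in measurable X]setTI; exact: measurable_funP.
Qed.

HB.instance Definition _ := Measure_isFinite.Build _ _ _ mpushforward fin.
End pushforward_finite.

Section independence_theory.
Context d (T : measurableType d) (R : realType) (Q : probability T R).

(** On D, the law of (Z, Y) is a product measure whose second factor is the
    law of Y restricted to D; uniqueness of product measures extends this from
    rectangles to all X. Restricting to D makes it possible to pass from pairs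
    to triples. *)
Lemma indep_pair_measure d1 d2 (T1 : measurableType d1) (T2 : measurableType d2)
    (Z : T -> T1) (Y : T -> T2) (D : set T) :
  measurable_fun setT Z -> measurable_fun setT Y -> measurable D ->
  (forall A B, measurable A -> measurable B ->
     Q (Z @^-1` A `&` (Y @^-1` B `&` D)) = (Q (Z @^-1` A) * Q (Y @^-1` B `&` D))%E) ->
  forall X : set (T1 * T2), measurable X ->
    Q ((fun w => (Z w, Y w)) @^-1` X `&` D) =
    (\int[Q]_w Q (Y @^-1` xsection X (Z w) `&` D))%E.
Proof.
move=> mZ mY mD ind X mX.
pose Z' : {mfun T >-> T1} := HB.pack Z (isMeasurableFun.Build _ _ _ _ Z mZ).
pose Y' : {mfun T >-> T2} := HB.pack Y (isMeasurableFun.Build _ _ _ _ Y mY).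
pose W := fun w => (Z' w, Y' w).
have mW : measurable_fun setT W by apply: measurable_fun_pair.
pose W' : {mfun T >-> (T1 * T2)%type} :=
  HB.pack W (isMeasurableFun.Build _ _ _ _ W mW).
have Doo : (Q D < +oo)%E by rewrite ltey_eq fin_num_measure.
pose QD : {finite_measure set T -> \bar R} := mfrestr mD Doo.
have := @product_measure_unique _ _ _ _ _ (mpushforward Q Z')
  (mpushforward QD Y') (mpushforward QD W').
have -> : Q (W @^-1` X `&` D) = mpushforward QD W' X by [].
move=> <- //.
  rewrite /product_measure1/= /mpushforward /=.
  rewrite (@ge0_integral_pushforward _ _ _ _ _ Z mZ Q setT)//.
  exact: (measurable_fun_xsection (mpushforward QD Y')).
move=> A B mA mB; rewrite /mpushforward/= /pushforward/= /mfrestr/mrestr.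
by rewrite -ind// setIA; congr (Q (_ `&` _)).
Qed.

(** Both sides are integrals over Z of the measures of sections in Y, and D is
    independent of these sections. *)
Lemma indep_pair_event d1 d2 (T1 : measurableType d1) (T2 : measurableType d2)
    (Z : T -> T1) (Y : T -> T2) (D : set T) :
  measurable_fun setT Z -> measurable_fun setT Y -> measurable D ->
  (forall A B, measurable A -> measurable B ->
     Q (Z @^-1` A `&` Y @^-1` B) = (Q (Z @^-1` A) * Q (Y @^-1` B))%E) ->
  (forall A B, measurable A -> measurable B ->
     Q (Z @^-1` A `&` (Y @^-1` B `&` D)) =
     (Q (Z @^-1` A) * (Q (Y @^-1` B) * Q D))%E) ->
  forall X : set (T1 * T2), measurable X ->
    Q ((fun w => (Z w, Y w)) @^-1` X `&` D) =
    (Q ((fun w => (Z w, Y w)) @^-1` X) * Q D)%E.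
Proof.
move=> mZ mY mD ind indD X mX.
have mpre d' (T' : measurableType d') (f : T -> T') A :
    measurable_fun setT f -> measurable A -> measurable (f @^-1` A).
  by move=> mf mA; rewrite -[X in measurable X]setTI; exact: mf.
have YD B : measurable B -> Q (Y @^-1` B `&` D) = (Q (Y @^-1` B) * Q D)%E.
  move=> mB; have := indD setT B measurableT mB.
  by rewrite preimage_setT setTI probability_setT mul1e.
rewrite indep_pair_measure//; last by move=> A B mA mB; rewrite indD// YD.
rewrite -[X in (Q X * _)%E]setIT.
rewrite (@indep_pair_measure _ _ _ _ Z Y setT)//; last first.
  by move=> A B mA mB; rewrite setIT ind.
rewrite -ge0_integralZr//.
- apply: eq_integral => w _; rewrite setIT YD//; exact: measurable_xsection.
- under eq_fun do rewrite setIT.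
  pose Y' : {mfun T >-> T2} := HB.pack Y (isMeasurableFun.Build _ _ _ _ Y mY).
  exact: (measurableT_comp (measurable_fun_xsection (mpushforward Q Y') mX) mZ).
Qed.

(** Fubini for the product law of (Z, Y). *)
Lemma indep_pair_integral d1 d2 (T1 : measurableType d1) (T2 : measurableType d2)
    (Z : T -> T1) (Y : T -> T2) (G : T1 * T2 -> \bar R) :
  measurable_fun setT Z -> measurable_fun setT Y ->
  (forall A B, measurable A -> measurable B ->
     Q (Z @^-1` A `&` Y @^-1` B) = (Q (Z @^-1` A) * Q (Y @^-1` B))%E) ->
  measurable_fun setT G -> (forall p, 0 <= G p)%E ->
  (\int[Q]_w G (Z w, Y w) = \int[Q]_w \int[Q]_v G (Z w, Y v))%E.
Proof.
move=> mZ mY ind mG G0.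
pose Z' : {mfun T >-> T1} := HB.pack Z (isMeasurableFun.Build _ _ _ _ Z mZ).
pose Y' : {mfun T >-> T2} := HB.pack Y (isMeasurableFun.Build _ _ _ _ Y mY).
pose W := fun w => (Z w, Y w).
have mW : measurable_fun setT W by apply: measurable_fun_pair.
pose W' : {mfun T >-> (T1 * T2)%type} :=
  HB.pack W (isMeasurableFun.Build _ _ _ _ W mW).
transitivity (\int[mpushforward Q W']_p G p)%E.
  by rewrite (@ge0_integral_pushforward _ _ _ _ _ W mW Q setT).
transitivity (\int[mpushforward Q Z' \x mpushforward Q Y']_p G p)%E.
  apply: eq_measure_integral => A mA _; apply/esym.
  by apply: product_measure_unique => // B C mB mC; rewrite /= -ind.
rewrite fubini_tonelli1//.
rewrite (@ge0_integral_pushforward _ _ _ _ _ Z mZ Q setT)//; last 2 first.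
- exact: (@measurable_fun_fubini_tonelli_F _ _ _ _ _ (mpushforward Q Y') _ mG).
- by move=> x _; exact: integral_ge0.
apply: eq_integral => w _ /=; rewrite /fubini_F.
rewrite (@ge0_integral_pushforward _ _ _ _ _ Y mY Q setT)//.
exact: measurableT_comp.
Qed.

(** As some A k may be the whole line, initial segments cover all finite
    subfamilies. *)
Definition indep_seq (g : nat -> T -> R) : Prop :=
  forall n (A : nat -> set R), (forall k, measurable (A k)) ->
    Q [set w | forall k, (k < n)%N -> A k (g k w)] =
      (\prod_(k < n) Q (g k @^-1` A k))%E.

Variable g : nat -> T -> R.
Hypothesis mg : forall k, measurable_fun setT (g k).
Hypothesis ig : indep_seq g.

(** Partial sums, stopped partial sums and killed walks are all Markov chains
    of this form, driven by independent variables g k. *)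
Fixpoint chain (phi : nat -> R * R -> R) (z : R) (k : nat) (w : T) : R :=
  if k is k'.+1 then phi k' (chain phi z k' w, g k' w) else z.

Variables (phi : nat -> R * R -> R) (z : R).
Hypothesis mphi : forall k, measurable_fun setT (phi k).

Lemma measurable_chain k : measurable_fun setT (chain phi z k).
Proof.
elim: k => [|k IH] /=; first exact: measurable_cst.
apply: (measurableT_comp (mphi k)); exact: measurable_fun_pair.
Qed.

Let future k n (A : nat -> set R) : set T :=
  [set w | forall j, (k <= j < n)%N -> A j (g j w)].

Let measurable_future k n A :
  (forall j, measurable (A j)) -> measurable (future k n A).
Proof.
move=> mA; rewrite (_ : future k n A =
    \bigcap_j (if (k <= j < n)%N then g j @^-1` A j else setT)).
  apply: bigcapT_measurable => j; case: ifP => // _.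
  by rewrite -[X in measurable X]setTI; exact: mg.
apply/seteqP; split => w /= Hw j.
  by move=> _; case: ifPn => // kj; apply: Hw.
by move=> kj; have := Hw j I; rewrite kj.
Qed.

Let Q_future k n A : (forall j, measurable (A j)) -> (k <= n)%N ->
  Q (future k n A) = (\prod_(k <= j < n) Q (g j @^-1` A j))%E.
Proof.
move=> mA kn.
pose B j := if (k <= j)%N then A j else setT.
have := ig n (A := B) _.
have -> : [set w | forall j, (j < n)%N -> B j (g j w)] = future k n A.
  apply/seteqP; split => w /= Hw j.
    by move=> /andP[kj jn]; have := Hw j jn; rewrite /B kj.
  by move=> jn; rewrite /B; case: ifPn => // kj; apply: Hw; rewrite kj.
move=> ->; last by move=> j; rewrite /B; case: ifP.
rewrite -(big_mkord xpredT (fun j => Q (g j @^-1` B j))) (@big_cat_nat _ _ _ k)//=.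
rewrite big_nat big1 ?mul1e; last first.
  move=> j /andP[_ jk]; rewrite /B leqNgt jk/= preimage_setT.
  exact: probability_setT.
by apply: eq_big_nat => j /andP[kj _]; rewrite /B kj.
Qed.

(** The induction carries along an arbitrary event A of the future: at each
    step the increment g k is taken out of the future and merged into the
    chain. *)
Let chain_future k n A B : (k <= n)%N -> measurable B ->
  (forall j, measurable (A j)) ->
  Q (chain phi z k @^-1` B `&` future k n A) =
  (Q (chain phi z k @^-1` B) * Q (future k n A))%E.
Proof.
elim: k n A B => [|k IH] n A B kn mB mA.
  have [zB|zB] := pselect (B z).
    have -> : chain phi z 0 @^-1` B = setT by apply/seteqP; split.
    by rewrite setTI probability_setT mul1e.
  have -> : chain phi z 0 @^-1` B = set0 by apply/seteqP; split.
  by rewrite set0I measure0 mul0e.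
have E C : future k n (fun j => if j == k then C else A j) =
    g k @^-1` C `&` future k.+1 n A.
  apply/seteqP; split => w /=.
    move=> Hw; split; first by have := Hw k; rewrite eqxx leqnn kn; apply.
    move=> j /andP[kj jn]; have := Hw j; rewrite (ltnW kj) jn.
    by rewrite gtn_eqF//; apply.
  move=> [Ck Hw] j /andP[kj jn]; case: ifPn => [/eqP->//|jk].
  by apply: Hw; rewrite jn andbT ltn_neqAle eq_sym jk.
pose X := phi k @^-1` B.
have -> : chain phi z k.+1 @^-1` B = (fun w => (chain phi z k w, g k w)) @^-1` X.
  by [].
have mX : measurable X by rewrite -[X]setTI; exact: mphi.
have mC C : measurable C -> forall j, measurable (if j == k then C else A j).
  by move=> mC j; case: ifP.
apply: (indep_pair_event (measurable_chain k) (mg k)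
   (measurable_future k.+1 n mA) _ _ mX).
- move=> C D mC' mD.
  have := IH k.+1 (fun=> D) C (leqnSn k) mC' (fun=> mD).
  have -> : future k k.+1 (fun=> D) = g k @^-1` D.
    apply/seteqP; split => w /=; first by apply; rewrite leqnn ltnSn.
    by move=> Dk j; rewrite ltnS -eqn_leq => /eqP <-.
  by [].
- move=> C D mC' mD; rewrite -E IH//; [|exact: ltnW|exact: mC].
  rewrite !Q_future//; [|exact: mC|exact: ltnW].
  rewrite big_ltn// eqxx; congr (_ * (_ * _))%E.
  by apply: eq_big_nat => j /andP[kj _]; rewrite gtn_eqF.
Qed.

(** The increment g k is independent of the chain at time k. *)
Lemma chain_integral k (G : R * R -> \bar R) :
  measurable_fun setT G -> (forall p, 0 <= G p)%E ->
  (\int[Q]_w G (chain phi z k w, g k w) =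
   \int[Q]_w \int[Q]_v G (chain phi z k w, g k v))%E.
Proof.
move=> mG G0; apply: (indep_pair_integral (measurable_chain k) (mg k)) => //.
move=> C D mC mD.
have := @chain_future k k.+1 (fun=> D) C (leqnSn k) mC (fun=> mD).
suff -> : future k k.+1 (fun=> D) = g k @^-1` D by [].
apply/seteqP; split => w /=; first by apply; rewrite leqnn ltnSn.
by move=> Dk j; rewrite ltnS -eqn_leq => /eqP <-.
Qed.

End independence_theory.

(** * Distribution functions and rearrangements *)

Section distribution_functions.
Context d (T : measurableType d) (R : realType) (mu : {measure set T -> \bar R}).
Implicit Types f g : T -> R.

Definition dfun f (s : R) : \bar R := mu [set x | s < `|f x|].

Lemma measurable_superlevel f s : measurable_fun setT f ->
  measurable [set x | s < `|f x|].
Proof.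
move=> mf; rewrite -[X in measurable X]setTI.
rewrite (_ : [set x | s < `|f x|] = (fun x => `|f x|) @^-1` `]s, +oo[).
  have mn : measurable_fun setT (fun x => `|f x|) by exact: measurableT_comp.
  by apply: mn => //; exact: measurable_itv.
by apply/seteqP; split => x /=; rewrite in_itv/= andbT.
Qed.

Lemma le_dfun f s t : measurable_fun setT f -> s <= t ->
  (dfun f t <= dfun f s)%E.
Proof.
move=> mf st; apply: le_measure; rewrite ?inE; try exact: measurable_superlevel.
by move=> x /=; apply: le_lt_trans.
Qed.

(** The function f is finite everywhere. This makes the set whose infimum
    defines rearr mu f t nonempty. *)
Lemma dfun_vanishes f (t : R) : measurable_fun setT f ->
  (dfun f 0 < +oo)%E -> 0 < t -> exists n : nat, (dfun f n%:R <= t%:E)%E.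
Proof.
move=> mf foo t0.
have /fine_cvgP[_] : (mu \o (fun n => [set x | n%:R < `|f x|])) n @[n --> \oo] --> 0%E.
  have <- : mu (\bigcap_n [set x | n%:R < `|f x|]) = 0%E.
    rewrite (_ : \bigcap_n _ = set0) ?measure0//; apply/seteqP; split => // x /= H.
    by have := H (Num.bound `|f x|) I => /=; rewrite ltNge ltW// archi_boundP.
  apply: nonincreasing_cvg_mu => //.
  - by move=> n; exact: measurable_superlevel.
  - by apply: bigcapT_measurable => n; exact: measurable_superlevel.
  - move=> m n mn; apply/subsetPset => x /=; apply: le_lt_trans.
    by rewrite ler_nat.
move=> /cvgrPdist_lt /(_ t t0) [N _ /(_ N (leqnn _))] /=.
rewrite sub0r normrN => H; exists N.
have fN : dfun f N%:R \is a fin_num.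
  by rewrite ge0_fin_numE// (le_lt_trans _ foo)// le_dfun.
by rewrite -(fineK fN) lee_fin (le_trans (ler_norm _))// ltW.
Qed.

(** The rearrangement is the generalized inverse of the distribution function;
    right continuity of the latter is what makes both inequalities strict. *)
Lemma lt_rearr f s t : measurable_fun setT f -> (dfun f 0 < +oo)%E ->
  0 <= s -> 0 < t -> (s < rearr mu f t) <-> (t%:E < dfun f s)%E.
Proof.
move=> mf foo s0 t0; rewrite /rearr.
set S := [set _ | _].
have hS : has_inf S.
  split; first by have [n nt] := dfun_vanishes mf foo t0; exists n%:R.
  by exists 0 => x [].
split.
  rewrite ltNge => sS; rewrite ltNge; apply: contra sS => ds.
  by apply: ge_inf; [exact: hS.2|split].
move=> tds.
have [n tn] : exists n : nat, (t%:E < dfun f (s + n.+1%:R^-1))%E.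
  apply: contrapT => /forallNP nt.
  have : (mu \o (fun n => [set x | s + n.+1%:R^-1 < `|f x|])) n @[n --> \oo]
      --> dfun f s.
    rewrite /dfun (_ : [set x | s < _] =
        \bigcup_n [set x | s + n.+1%:R^-1 < `|f x|]).
      apply: nondecreasing_cvg_mu.
      - by move=> n; exact: measurable_superlevel.
      - by apply: bigcupT_measurable => n; exact: measurable_superlevel.
      - move=> m n mn; apply/subsetPset => x /=; apply: le_lt_trans.
        by rewrite lerD2l lef_pV2 ?posrE// ler_nat ltnS.
    apply/seteqP; split => x /=.
      move=> sx; have [n] := ltr_add_invr sx.
      by exists n.
    by move=> [n _ /=]; apply: le_lt_trans; rewrite lerDl.
  move=> cv; move: tds; rewrite ltNge => /negP; apply.
  rewrite -(cvg_lim _ cv)//; apply: lime_le; first by apply/cvg_ex; eexists; exact: cv.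
  by apply: nearW => m; have /negP := nt m; rewrite -leNgt.
apply: (@lt_le_trans _ _ (s + n.+1%:R^-1)); first by rewrite ltrDl invr_gt0 ltr0n.
apply: lb_le_inf; first exact: hS.1.
move=> r [r0 dr]; rewrite leNgt; apply/negP => rs.
by move: tn; rewrite ltNge (le_trans _ dr)// le_dfun// ltW.
Qed.

Lemma rearr_ge0 f t : 0 <= rearr mu f t.
Proof.
rewrite /rearr; set S := [set _ | _].
have [->|/set0P S0] := eqVneq S set0; first by rewrite inf0.
by apply: lb_le_inf => // x [].
Qed.

Lemma rearr_nonincreasing f (t t' : R) : measurable_fun setT f ->
  (dfun f 0 < +oo)%E -> 0 < t -> t <= t' -> rearr mu f t' <= rearr mu f t.
Proof.
move=> mf foo t0 tt'; rewrite leNgt; apply/negP.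
move/(lt_rearr mf foo (rearr_ge0 _ _) (lt_le_trans t0 tt')) => H.
have : (t%:E < dfun f (rearr mu f t))%E by apply: le_lt_trans H; rewrite lee_fin.
by move/(lt_rearr mf foo (rearr_ge0 _ _) t0); rewrite ltxx.
Qed.

End distribution_functions.

(** * The unit interval *)

Section lambda01_theory.
Context (R : realType).
Implicit Types (A B : set R) (f g u : R -> R).

Lemma lambda01_interior A : measurable A ->
  lambda01 A = lebesgue_measure (A `&` `]0, 1[).
Proof.
move=> mA.
have m1 (a : R) : measurable ([set a] : set R) by exact: measurable_set1.
have null : lebesgue_measure ([set 0] `|` [set 1] : set R) = 0%E.
  apply: (etrans (y := lebesgue_measure ([set 0] : set R))); last first.
    exact: lebesgue_measure_set1.
  by apply: measureU0 => //; exact: lebesgue_measure_set1.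
rewrite /lambda01 /mrestr.
have -> : A `&` `[0, 1] = (A `&` `]0, 1[) `|` (A `&` ([set 0] `|` [set 1])).
  rewrite -setIUr; congr (_ `&` _).
  apply/seteqP; split => t /=; rewrite !in_itv/=.
    move=> /andP[t0 t1]; have [->|tn0] := eqVneq t 0; first by right; left.
    have [->|tn1] := eqVneq t 1; first by right; right.
    by left; rewrite lt0r tn0 t0/= lt_neqAle tn1.
  by case=> [/andP[t0 t1]|[->|->]]; rewrite ?lexx ?ler01// !ltW.
rewrite measureU0//.
- by apply: measurableI => //; exact: measurable_itv.
- by apply: measurableI => //; apply: measurableU.
- apply: (@subset_measure0 _ _ _ lebesgue_measure _ _ _ _ (@subIsetr _ _ _)) null.
    by apply: measurableI => //; apply: measurableU.
  exact: measurableU.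
Qed.

Lemma lambda01_ext A B : measurable A -> measurable B ->
  (forall t, 0 < t < 1 -> A t <-> B t) -> lambda01 A = lambda01 B.
Proof.
move=> mA mB AB; rewrite !lambda01_interior//; congr (lebesgue_measure _).
by apply/seteqP; split => t /= [At t01]; split => //;
  move: t01; rewrite in_itv/= => /AB[]; auto.
Qed.

Lemma lambda01_itv (a b : R) : 0 <= a -> a <= b -> b <= 1 ->
  lambda01 `]a, b[ = (b - a)%:E.
Proof.
move=> a0 ab b1; rewrite /lambda01 /mrestr (_ : _ `&` _ = [set` `]a, b[]).
  rewrite lebesgue_measure_itv/= lte_fin; case: ltP => // ba.
  by rewrite (@le_anti _ _ a b) ?subrr// ab.
apply/seteqP; split => t /=; rewrite !in_itv/=; first by case.
by move=> /andP[ta tb]; rewrite ta tb; split => //; rewrite ?(ltW (le_lt_trans a0 ta)) ?(ltW (lt_le_trans tb b1)).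
Qed.

(** Superlevel sets of a rearrangement are initial intervals of ]0, 1[, up to
    the endpoints. *)
Lemma lambda01_ray A (c : \bar R) : measurable A -> (0 <= c)%E ->
  (forall t, 0 < t < 1 -> A t <-> (t%:E < c)%E) -> lambda01 A = mine c 1%E.
Proof.
move=> mA c0 Ac; have [c1|c1] := leP c 1%E; last first.
  rewrite (@lambda01_ext _ `]0, 1[)//.
    by rewrite lambda01_itv// subr0.
  move=> t t01; rewrite Ac//= in_itv/= t01; split => // _.
  by rewrite (lt_trans _ c1)// lte_fin; case/andP: t01.
have cfin : c \is a fin_num by rewrite ge0_fin_numE// (le_lt_trans c1)// ltry.
move: c0 c1 Ac; rewrite -(fineK cfin); move: (fine c) => r.
rewrite !lee_fin => r0 r1 Ac.
rewrite (@lambda01_ext _ `]0, r[)//.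
  by rewrite lambda01_itv// subr0.
move=> t /andP[t0 t1]; rewrite Ac/= ?t0//= in_itv/= t0 lte_fin; split => //.
Qed.

(** Superlevel sets of the mirror image of a rearrangement. *)
Lemma lambda01_reflected_ray A (c : \bar R) : measurable A -> (0 <= c)%E ->
  (forall t, 0 < t < 1 -> A t <-> ((1 - t)%:E < c)%E) ->
  lambda01 A = mine c 1%E.
Proof.
move=> mA c0 Ac; have [c1|c1] := leP c 1%E; last first.
  rewrite (@lambda01_ext _ `]0, 1[)//.
    by rewrite lambda01_itv// subr0.
  move=> t t01; rewrite Ac//= in_itv/= t01; split => // _.
  by rewrite (lt_trans _ c1)// lte_fin; case/andP: t01; lra.
have cfin : c \is a fin_num by rewrite ge0_fin_numE// (le_lt_trans c1)// ltry.
move: c0 c1 Ac; rewrite -(fineK cfin); move: (fine c) => r.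
rewrite !lee_fin => r0 r1 Ac.
rewrite (@lambda01_ext _ `](1 - r), 1[)//.
  by rewrite lambda01_itv//; [congr (_%:E)|..]; lra.
move=> t /andP[t0 t1]; rewrite Ac/= ?t0//= in_itv/= t1 lte_fin andbT.
by split; lra.
Qed.

Lemma dfun01_le1 f s : measurable_fun setT f -> (dfun lambda01 f s <= 1)%E.
Proof. by move=> mf; apply: probability_le1; exact: measurable_superlevel. Qed.

Lemma dfun01_fin f s : measurable_fun setT f -> (dfun lambda01 f s < +oo)%E.
Proof. by move=> mf; rewrite (le_lt_trans (dfun01_le1 s mf))// ltry. Qed.

End lambda01_theory.

(** * Rearrangements on the unit interval *)

Section rearrangements.
Context d (T : measurableType d) (R : realType) (mu : {measure set T -> \bar R}).
Variable f : T -> R.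
Hypotheses (mf : measurable_fun setT f) (foo : (dfun mu f 0 < +oo)%E).

Lemma measurable_rearr : measurable_fun setT (rearr mu f).
Proof.
apply: (measurability _ (RGenOInfty.measurableE R)) => /= _ [_ [x ->] <-].
rewrite setTI; have [x0|x0] := ltP x 0.
  rewrite (_ : _ @^-1` _ = setT); first exact: measurableT.
  apply/seteqP; split => // t _ /=; rewrite in_itv/= andbT.
  exact: lt_le_trans (rearr_ge0 _ _ _).
rewrite (_ : _ @^-1` _ = (`]0, +oo[ `&` [set t | (t%:E < dfun mu f x)%E])
   `|` ([set 0] `&` [set t : R | x < rearr mu f t])).
  apply: measurableU.
    apply: measurableI; first exact: measurable_itv.
    rewrite -[X in measurable X]setTI; apply: emeasurable_fun_infty_o => //.
  have [H|H] := pselect (x < rearr mu f 0).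
    by rewrite (_ : _ `&` _ = [set 0])//; apply/seteqP; split => t /= => [[]|->].
  by rewrite (_ : _ `&` _ = set0)//; apply/seteqP; split => t //= [->].
apply/seteqP; split => t /=; rewrite !in_itv/= !andbT.
  move=> xt; have [t0|t0|t0] := ltgtP t 0; last by right; split; rewrite -?t0.
    move: xt; rewrite /rearr (_ : [set s | _] = set0) ?inf0 ?ltNge ?x0//.
    apply/seteqP; split => // s /= [_]; rewrite leNgt => /negP; apply.
    by rewrite (@lt_le_trans _ _ 0%E)// ?lte_fin// measure_ge0//; exact: measurable_superlevel.
  by left; split => //; apply/(lt_rearr mf foo x0 t0).
by move=> [[t0 xt]|[->//]]; apply/(lt_rearr mf foo x0 t0).
Qed.

(** The total mass of the unit interval caps the distribution function at 1.
    Only values on ]0, 1[ count, so u may also be a rearrangement cut off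
    outside [0, 1]. *)
Lemma dfun_rearr (u : R -> R) s : measurable_fun setT u ->
  (forall t, 0 < t < 1 -> u t = rearr mu f t) -> 0 <= s ->
  dfun lambda01 u s = mine (dfun mu f s) 1%E.
Proof.
move=> mu' ut s0; apply: lambda01_ray; first exact: measurable_superlevel.
  by rewrite measure_ge0//; exact: measurable_superlevel.
move=> t t01 /=; rewrite ut// ger0_norm ?rearr_ge0//; apply: lt_rearr => //.
by case/andP: t01.
Qed.

Lemma dfun_reflected_rearr (u : R -> R) s : measurable_fun setT u ->
  (forall t, 0 < t < 1 -> u t = rearr mu f (1 - t)) -> 0 <= s ->
  dfun lambda01 u s = mine (dfun mu f s) 1%E.
Proof.
move=> mu' ut s0; apply: lambda01_reflected_ray; first exact: measurable_superlevel.
  by rewrite measure_ge0//; exact: measurable_superlevel.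
move=> t t01 /=; rewrite ut// ger0_norm ?rearr_ge0//; apply: lt_rearr => //.
by case/andP: t01; lra.
Qed.

End rearrangements.

(** * Norm estimates from distribution functions *)

Section symmetric_spaces.
Context (R : realType) (X : fspace R).
Hypothesis sX : symmetric_space X.
Let bX := ss_banach sX.
Implicit Types f g : R -> R.

(** Comparing rearrangements at t > 0 amounts to comparing distribution
    functions, which are easier to compute. *)
Lemma ss_dom f g : X f -> measurable_fun setT g ->
  (forall s : R, (0 <= s)%R -> dfun lambda01 g s <= dfun lambda01 f s)%E ->
  X g /\ fs_norm X g <= fs_norm X f.
Proof.
move=> Xf mg gf; have mf := bfs_measurable bX Xf.
apply: (ss_rearr sX Xf mg) => t t0; rewrite leNgt; apply/negP.
move/(lt_rearr (mu := lambda01) mg (dfun01_fin 0 mg) (rearr_ge0 _ _ _) t0) => H.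
have := lt_le_trans H (gf _ (rearr_ge0 _ _ _)).
by move/(lt_rearr (mu := lambda01) mf (dfun01_fin 0 mf) (rearr_ge0 _ _ _) t0); rewrite ltxx.
Qed.

Lemma ss_le f g : X f -> measurable_fun setT g -> (forall x, `|g x| <= `|f x|) ->
  X g /\ fs_norm X g <= fs_norm X f.
Proof.
move=> Xf mg gf; have mf := bfs_measurable bX Xf.
apply: ss_dom => // s s0.
apply: le_measure; rewrite ?inE; try exact: measurable_superlevel.
by move=> x /= /lt_le_trans; apply.
Qed.

(** The rearrangement u of f and its mirror image u(1 - t) both have the
    distribution of f. Their sum exceeds s near both ends of ]0, 1[, that is
    on a set of twice the measure, or everywhere. *)
Lemma ss_double f : X f -> exists f',
  [/\ X f', fs_norm X f' <= 2 * fs_norm X f &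
   forall s : R, 0 <= s ->
     (mine (2%:E * dfun lambda01 f s) 1 <= dfun lambda01 f' s)%E].
Proof.
move=> Xf; have mf := bfs_measurable bX Xf.
have foo := dfun01_fin 0 mf.
pose u := rearr lambda01 f; pose v t := u (1 - t).
have mu : measurable_fun setT u.
  exact: (measurable_rearr (mu := lambda01)).
have mv : measurable_fun setT v.
  by apply: (measurableT_comp mu); apply: measurable_funB => //; exact: measurable_cst.
have du s : 0 <= s -> dfun lambda01 u s = dfun lambda01 f s.
  move=> s0; rewrite (dfun_rearr (mu := lambda01) mf)//.
  by apply/min_idPl; exact: dfun01_le1.
have dv s : 0 <= s -> dfun lambda01 v s = dfun lambda01 f s.
  move=> s0; rewrite (dfun_reflected_rearr (mu := lambda01) mf)//.
  by apply/min_idPl; exact: dfun01_le1.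
have [Xu nu] : X u /\ fs_norm X u <= fs_norm X f.
  by apply: ss_dom => // s s0; rewrite du.
have [Xv nv] : X v /\ fs_norm X v <= fs_norm X f.
  by apply: ss_dom => // s s0; rewrite dv.
have Xuv := bfs_D bX Xu Xv.
exists (u \+ v); split => //.
  apply: (le_trans (bfs_normD bX Xu Xv)).
  by rewrite mulr_natl mulr2n lerD.
move=> s s0.
have fin : dfun lambda01 f s \is a fin_num.
  by rewrite ge0_fin_numE ?dfun01_fin// measure_ge0//; exact: measurable_superlevel.
set r := fine (dfun lambda01 f s).
have r0 : 0 <= r.
  by rewrite fine_ge0// measure_ge0//; exact: measurable_superlevel.
have r1 : r <= 1 by rewrite -lee_fin fineK// dfun01_le1.
have Hu t : 0 < t < 1 -> (s < u t) <-> t < r.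
  move=> /andP[t0 t1]; have -> : (t < r) = (t%:E < dfun lambda01 f s)%E.
    by rewrite -(fineK fin) lte_fin.
  exact: (lt_rearr (mu := lambda01) mf foo s0 t0).
have Hv t : 0 < t < 1 -> (s < v t) <-> 1 - t < r.
  by move=> t01; apply: Hu; lra.
have u0 t : 0 <= u t by exact: rearr_ge0.
have v0 t : 0 <= v t by exact: rearr_ge0.
have uv t : 0 < t < 1 -> t < r \/ 1 - t < r -> s < `|(u \+ v) t|.
  move=> t01 H; rewrite /= ger0_norm ?addr_ge0//.
  case: H => [/Hu|/Hv] /(_ t01); have := u0 t; have := v0 t; lra.
have muv : measurable [set x | s < `|(u \+ v) x|].
  by apply: measurable_superlevel; exact: measurable_funD.
(* Beyond 1/2 the two end intervals cover ]0, 1[. *)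
have [r12|r12] := leP r 2^-1; last first.
  apply: (@le_trans _ _ 1%E); first by rewrite ge_min lexx orbT.
  rewrite (_ : 1%E = lambda01 (`]0, 1[ : set R)); last first.
    by rewrite lambda01_itv// subr0.
  have m01 : measurable (`]0, 1[%classic : set R) by exact: measurable_itv.
  apply: le_measure; rewrite ?inE//.
  move=> t /=; rewrite in_itv/= => t01; apply: uv => //.
  by have [tr|tr] := ltP t r; [left|right; lra].
apply: (@le_trans _ _ (2 * r)%:E).
  by rewrite ge_min EFinM /r fineK// lexx.
have -> : (2 * r)%:E = lambda01 (`]0, r[ `|` `](1 - r), 1[ : set R).
  rewrite measureU; [|exact: measurable_itv|exact: measurable_itv|].
    have -> : (2 * r)%:E = ((r - 0)%:E + (1 - (1 - r))%:E)%E.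
      by rewrite -EFinD; congr (_%:E); lra.
    by congr (_ + _)%E; apply/esym; apply: lambda01_itv => //; lra.
  by apply/seteqP; split => // t /= []; rewrite !in_itv/=; lra.
have mU : measurable (`]0, r[ `|` `](1 - r), 1[ : set R).
  by apply: measurableU; exact: measurable_itv.
apply: le_measure; rewrite ?inE//.
by move=> t /= [|]; rewrite in_itv/= => /andP[ta tb]; apply: uv; lra.
Qed.

Lemma ss_dilate2 f g : X f -> measurable_fun setT g ->
  (forall s : R, (0 <= s)%R -> dfun lambda01 g s <= 2%:E * dfun lambda01 f s)%E ->
  X g /\ fs_norm X g <= 2 * fs_norm X f.
Proof.
move=> Xf mg gf; have [f' [Xf' nf' df']] := ss_double Xf.
have [Xg ng] : X g /\ fs_norm X g <= fs_norm X f'.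
  apply: (ss_dom Xf' mg) => s s0; apply: le_trans (df' s s0).
  by rewrite le_min gf// dfun01_le1.
by split => //; exact: le_trans nf'.
Qed.

Lemma ss_dilate4 f g : X f -> measurable_fun setT g ->
  (forall s : R, (0 <= s)%R -> dfun lambda01 g s <= 4%:E * dfun lambda01 f s)%E ->
  X g /\ fs_norm X g <= 4 * fs_norm X f.
Proof.
move=> Xf mg gf; have [f' [Xf' nf' df']] := ss_double Xf.
have [Xg ng] : X g /\ fs_norm X g <= 2 * fs_norm X f'.
  apply: (ss_dilate2 Xf' mg) => s s0.
  apply: (@le_trans _ _ (2%:E * mine (2%:E * dfun lambda01 f s) 1)%E); last first.
    by apply: lee_wpmul2l => //; exact: df'.
  have [_|_] := leP (2%:E * dfun lambda01 f s)%E 1%E.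
    by rewrite muleA -EFinM (_ : 2 * 2 = 4)// ?gf//; ring.
  by rewrite mule1 (le_trans (dfun01_le1 s mg))// lee_fin ler1n.
split => //; apply: (le_trans ng).
by have := ler_wpM2l (ler0n R 2) nf'; lra.
Qed.

End symmetric_spaces.

(** * Integrals and equality of laws *)

Section equal_laws.
Context (R : realType).

(** Rays form a generating class closed under intersection. *)
Lemma eq_measure_rays (m1 m2 : {measure set (measurableTypeR R) -> \bar R}) :
  (m1 setT < +oo)%E ->
  (forall c : R, m1 `]c, +oo[%classic = m2 `]c, +oo[%classic) ->
  forall A, measurable A -> m1 A = m2 A.
Proof.
move=> m1oo m12 A mA.
refine (@measure_unique _ R (measurableTypeR R) (@RGenOInfty.G R)
  (fun n => `]- n%:R, +oo[%classic) _ _ _ _ m1 m2 _ _ A mA).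
- exact: RGenOInfty.measurableE.
- move=> _ _ [a ->] [b ->]; exists (Num.max a b).
  apply/seteqP; split => t /=; rewrite !in_itv/= !andbT gt_max.
    by move=> [-> ->].
  by move=> /andP[].
- by move=> n; eexists.
- apply/seteqP; split => // t _; exists (Num.bound `|t|) => //=.
  rewrite in_itv/= andbT ltrNl (le_lt_trans (ler_norm _))// normrN.
  by rewrite archi_boundP.
- by move=> _ [c ->]; exact: m12.
- move=> k; apply: le_lt_trans m1oo; apply: le_measure; rewrite ?inE//.
Qed.

Lemma ge0_integral_mrestr d (T : measurableType d) (m : {measure set T -> \bar R})
    (D : set T) (mD : measurable D) (f : T -> \bar R) :
  measurable_fun setT f -> (forall x, 0 <= f x)%E ->
  (\int[mrestr m mD]_x f x = \int[m]_(x in D) f x)%E.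
Proof.
move=> mf f0.
rewrite (@ge0_negligible_integral _ _ _ _ setT (~` D))//; last 2 first.
- exact: measurableC.
- by rewrite /= /mrestr setICl measure0.
rewrite setTD setCK; apply: eq_measure_integral => A mA AD.
by rewrite /= /mrestr setIidl.
Qed.

Lemma eq_law_integral d1 d2 (T1 : measurableType d1) (T2 : measurableType d2)
    (m1 : {measure set T1 -> \bar R}) (m2 : {measure set T2 -> \bar R})
    (f1 : T1 -> R) (f2 : T2 -> R) (G : R -> \bar R) :
  (m1 setT < +oo)%E ->
  measurable_fun setT f1 -> measurable_fun setT f2 ->
  (forall c, m1 [set x | c < f1 x] = m2 [set x | c < f2 x]) ->
  measurable_fun setT G -> (forall y, 0 <= G y)%E ->
  (\int[m1]_x G (f1 x) = \int[m2]_x G (f2 x))%E.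
Proof.
move=> m1oo mf1 mf2 m12 mG G0.
have mf1' : measurable_fun setT (f1 : T1 -> measurableTypeR R) by exact: mf1.
have mf2' : measurable_fun setT (f2 : T2 -> measurableTypeR R) by exact: mf2.
pose p1 := measure_function_pushforward__canonical__measure_function_Measure m1 mf1'.
pose p2 := measure_function_pushforward__canonical__measure_function_Measure m2 mf2'.
transitivity (\int[p1]_y G y)%E.
  by apply/esym; apply: (etrans (ge0_integral_pushforward mf1' m1 measurableT _ _)).
transitivity (\int[p2]_y G y)%E.
  apply: eq_measure_integral => A mA _.
  apply: (@eq_measure_rays p1 p2) => //.
  move=> c; rewrite /= /pushforward.
  have E (T : Type) (f : T -> R) : f @^-1` `]c, +oo[%classic = [set x | c < f x].
    by apply/seteqP; split => x /=; rewrite in_itv/= andbT.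
  by rewrite !E.
by apply: (etrans (ge0_integral_pushforward mf2' m2 measurableT _ _)).
Qed.

End equal_laws.

(** * Sums and constants in a symmetric space *)

Section sum_in_space.
Context (R : realType) (X : fspace R).
Hypothesis sX : symmetric_space X.
Let bX := ss_banach sX.

Lemma ss_le01 (f g : R -> R) : X f -> measurable_fun setT g ->
  (forall t, 0 < t < 1 -> `|g t| <= `|f t|) ->
  X g /\ fs_norm X g <= fs_norm X f.
Proof.
move=> Xf mg gf; have mf := bfs_measurable bX Xf.
have m01 : measurable (`]0, 1[%classic : set R) by exact: measurable_itv.
apply: (ss_dom sX Xf mg) => s s0; rewrite /dfun.
have mgs := measurable_superlevel s mg.
apply: (@le_trans _ _ (lambda01 ([set x | s < `|g x|] `&` `]0, 1[%classic))).
  rewrite le_eqVlt; apply/orP; left; apply/eqP; apply: lambda01_ext => //.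
    exact: measurableI.
  by move=> t t01; split => [gt|[]//]; split => //=; rewrite in_itv.
apply: le_measure; rewrite ?inE//.
- exact: measurableI.
- exact: measurable_superlevel.
- by move=> t [/= sg]; rewrite in_itv/= => t01; rewrite (lt_le_trans sg)// gf.
Qed.

Lemma ss_sum (I : Type) (r : seq I) (g : I -> R -> R) : (forall i, X (g i)) ->
  X (fun t => \sum_(i <- r) g i t) /\
  fs_norm X (fun t => \sum_(i <- r) g i t) <= \sum_(i <- r) fs_norm X (g i).
Proof.
move=> Xg; elim: r => [|i r [IH1 IH2]].
  have -> : (fun t => \sum_(i <- [::]) g i t) = cst 0 :> (R -> R).
    by apply/funext => t; rewrite big_nil.
  rewrite big_nil; split; first exact: bfs_0 bX.
  rewrite le_eqVlt; apply/orP; left; apply/eqP.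
  by apply/(bfs_norm_eq0 bX (bfs_0 bX)); apply: aeW.
have -> : (fun t => \sum_(i <- i :: r) g i t) =
    g i \+ (fun t => \sum_(i <- r) g i t).
  by apply/funext => t; rewrite big_cons.
rewrite big_cons; split; first exact: bfs_D.
by apply: (le_trans (bfs_normD bX (Xg i) IH1)); rewrite lerD2l.
Qed.

Lemma ss_cst : X (cst 1) /\ fs_norm X (cst 1) = 1.
Proof.
have m1 : measurable_fun setT (cst 1 : R -> R) by exact: measurable_cst.
have m01 : measurable (`]0, 1[%classic : set R) by exact: measurable_itv.
have mi : measurable_fun setT (\1_(`]0, 1[%classic) : R -> R).
  exact: measurable_indic.
have H s : dfun lambda01 (cst 1 : R -> R) s = dfun lambda01 (\1_(`]0, 1[%classic) : R -> R) s.
  apply: lambda01_ext; [exact: measurable_superlevel|exact: measurable_superlevel|].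
  by move=> t t01 /=; rewrite indicE mem_set//= in_itv.
have [X1 n1] : X (cst 1) /\ fs_norm X (cst 1) <= fs_norm X \1_(`]0, 1[%classic).
  by apply: (ss_dom sX (ss_indic sX)) => // s _; rewrite H.
split => //; apply/eqP; rewrite eq_le -[X in _ <= X](ss_normalized sX) n1/=.
rewrite -[X in X <= _](ss_normalized sX).
by apply: (ss_dom sX X1 _ _).2 => // s _; rewrite H.
Qed.

Lemma ss_cstZ (c : R) : 0 <= c -> X (cst c) /\ fs_norm X (cst c) = c.
Proof.
have [X1 n1] := ss_cst; move=> c0.
have -> : cst c = c \*o cst 1 :> (R -> R) by apply/funext => t /=; rewrite mulr1.
split; first exact: bfs_Z.
by rewrite (bfs_normZ bX)// n1 mulr1 ger0_norm.
Qed.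

End sum_in_space.

(** * Step functions *)

Section step_functions.
Context (R : realType) (n : nat).
Let N : R := n.+1%:R.
Let N0 : 0 < N. Proof. by rewrite ltr0n. Qed.

Definition cell (k : nat) : set R := `[k%:R / n.+1%:R, k.+1%:R / n.+1%:R[%classic.

Lemma measurable_cell k : measurable (cell k).
Proof. exact: measurable_itv. Qed.

Lemma in_cell k t : cell k t <-> 0 <= t /\ Num.truncn (t * n.+1%:R) = k.
Proof.
rewrite /cell /= in_itv/= ler_pdivrMr// ltr_pdivlMr//; split.
  move=> tk; split; last exact: truncn_def.
  by rewrite -(@pmulr_lge0 _ n.+1%:R)// (le_trans _ (andP tk).1).
move=> [t0 <-]; apply: truncn_itv; exact: mulr_ge0.
Qed.

Lemma lambda01_cell k : (k < n.+1)%N -> lambda01 (cell k) = (n.+1%:R^-1 : R)%:E.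
Proof.
move=> kn; rewrite /lambda01 /mrestr (_ : _ `&` _ = cell k).
  rewrite /cell lebesgue_measure_itv/= lte_fin ltr_pM2r ?invr_gt0//.
  by rewrite ltr_nat ltnSn -EFinB -mulrBl -natrB// subSn// subnn mul1r.
apply/seteqP; split => t /=; rewrite /cell/= !in_itv/=; first by case.
move=> /andP[t0 t1]; rewrite t0 t1; split => //; apply/andP; split.
  by rewrite (le_trans _ t0)// divr_ge0// ltW.
rewrite (le_trans (ltW t1))// ler_pdivrMr// mul1r ler_nat//.
Qed.

Definition step (a : 'I_n.+1 -> R) (t : R) : R := \sum_k a k * \1_(cell k) t.

Lemma step_cell a k t : cell k t -> (k < n.+1)%N -> step a t = a (inord k).
Proof.
move=> tk kn; rewrite /step (bigD1 (inord k))//= inordK// indicE mem_set// mulr1.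
rewrite big1 ?addr0// => j jk; rewrite indicE memNset ?mulr0//.
move=> /in_cell[_ tj]; move/in_cell: tk => [_ tk].
by move/eqP: jk; apply; apply/val_inj; rewrite /= inordK// -tk.
Qed.

Lemma step_out a t : ~ (0 <= t < 1) -> step a t = 0.
Proof.
move=> t01; rewrite /step big1// => k _; rewrite indicE memNset ?mulr0//.
rewrite /cell/= in_itv/= => /andP[t0 t1]; apply: t01.
rewrite (le_trans _ t0) ?divr_ge0//= (lt_le_trans t1)//.
by rewrite ler_pdivrMr// mul1r ler_nat.
Qed.

Lemma cell_ex t : 0 <= t < 1 -> exists2 k, (k < n.+1)%N & cell k t.
Proof.
move=> /andP[t0 t1]; exists (Num.truncn (t * n.+1%:R)); last by apply/in_cell.
rewrite ltnS truncn_le_nat -[X in _ < X]mul1r ltr_pM2r//.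
Qed.

Lemma measurable_step a : measurable_fun setT (step a).
Proof.
rewrite /step; apply: measurable_sum => k.
by apply: measurable_funM; [exact: measurable_cst|apply: measurable_indic; exact: measurable_cell].
Qed.

Lemma integral_step a : (forall k, 0 <= a k) ->
  (\int[lambda01]_t (step a t)%:E = (n.+1%:R^-1 * \sum_k a k)%:E)%E.
Proof.
move=> a0.
transitivity (\int[lambda01]_t \sum_(k < n.+1) ((a k)%:E * (\1_(cell k) t)%:E))%E.
  by apply: eq_integral => t _; rewrite /step -sumEFin.
rewrite ge0_integral_sum//; last 2 first.
- move=> k; apply: emeasurable_funM; first exact: measurable_cst.
  by apply/measurable_EFinP; apply: measurable_indic; exact: measurable_cell.
- by move=> k t _; rewrite -EFinM lee_fin mulr_ge0// indicE.
rewrite mulr_sumr -sumEFin; apply: eq_bigr => k _.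
rewrite ge0_integralZl_EFin//; last first.
  by apply/measurable_EFinP; apply: measurable_indic; exact: measurable_cell.
rewrite integral_indic//; last exact: measurable_cell.
transitivity ((a k)%:E * lambda01 (cell k))%E; first by rewrite -[in RHS](setIT (cell k)).
by rewrite lambda01_cell// -EFinM mulrC.
Qed.

Lemma dfun_step a s : (forall k, 0 <= a k) -> 0 <= s ->
  dfun lambda01 (step a) s = (n.+1%:R^-1 * \sum_k (s < a k)%R%:R)%:E.
Proof.
move=> a0 s0; rewrite -integral_step; last by move=> k; rewrite ler0n.
rewrite /dfun -[X in _ X = _]setIT -integral_indic//; last first.
  by apply: measurable_superlevel; exact: measurable_step.
apply: eq_integral => t _; congr (_%:E); rewrite indicE.
have [t01|t01] := pselect (0 <= t < 1); last first.
  rewrite step_out// memNset//= step_out// normr0; apply/negP.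
  by rewrite -leNgt.
have [k kn tk] := cell_ex t01; rewrite (step_cell _ tk)//.
have [H|H] := boolP (s < a (inord k)).
  by rewrite mem_set//= (step_cell _ tk)// ger0_norm.
by rewrite memNset//= (step_cell _ tk)// ger0_norm//; apply/negP.
Qed.

End step_functions.

(** * Symmetric spaces embed in L1 *)

Section L1_embedding.
Context (R : realType) (X : fspace R).
Hypothesis sX : symmetric_space X.
Let bX := ss_banach sX.

(** Averaging a step function over the cyclic shifts of its values gives a
    constant, and all shifts have the same distribution. *)
Lemma ss_step_mean n (a : 'I_n.+1 -> R) : (forall k, 0 <= a k) -> X (step a) ->
  n.+1%:R^-1 * \sum_k a k <= fs_norm X (step a).
Proof.
move=> a0 Xa; pose q (i : 'I_n.+1) := step (fun k => a (k + i)).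
have qP i : X (q i) /\ fs_norm X (q i) <= fs_norm X (step a).
  apply: (ss_dom sX Xa); first exact: measurable_step.
  move=> s s0; rewrite !dfun_step//.
  by rewrite [X in (_ <= (_ * X)%:E)%E](reindex_inj (addIr i)).
have [Xs ns] := ss_sum sX (index_enum 'I_n.+1) (fun i => (qP i).1).
set c := \sum_k a k; have c0 : 0 <= c by exact: sumr_ge0.
have [_ nc] := ss_cstZ sX c0.
have [_] : X (cst c) /\ fs_norm X (cst c) <= fs_norm X (fun t => \sum_i q i t).
  apply: (ss_dom sX Xs); first exact: measurable_cst.
  move=> s s0; rewrite le_eqVlt; apply/orP; left; apply/eqP.
  apply: lambda01_ext.
  - by apply: measurable_superlevel; exact: measurable_cst.
  - by apply: measurable_superlevel; exact: (bfs_measurable bX Xs).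
  - move=> t /andP[t0 t1] /=; suff -> : \sum_i q i t = c by [].
    have [|k kn tk] := @cell_ex R n t; first by rewrite (ltW t0).
    under eq_bigr do rewrite /q (step_cell _ tk)//.
    by rewrite /c [RHS](reindex_inj (addrI (inord k))).
rewrite nc => cle; rewrite mulrC ler_pdivrMr//.
apply: (le_trans cle); apply: (le_trans ns).
apply: (le_trans (ler_sum _ (fun i _ => (qP i).2))).
by rewrite sumr_const card_ord mulr_natr.
Qed.

(** A lower Riemann sum of the rearrangement is the mean of a step function
    below it. The first cell is left out since the rearrangement may be
    unbounded there. *)
Lemma ss_riemann (f : R -> R) n : X f ->
  (\int[lambda01]_(t in `[(n.+1%:R^-1)%R, 1%R[) (rearr lambda01 f t)%:E <=
   (fs_norm X f)%:E)%E.
Proof.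
move=> Xf; have mf := bfs_measurable bX Xf; have foo := dfun01_fin 0 mf.
pose u := rearr lambda01 f; have u0 t : 0 <= u t by exact: rearr_ge0.
have mu : measurable_fun setT u by exact: (measurable_rearr (mu := lambda01)).
have N0 : 0 < n.+1%:R :> R by rewrite ltr0n.
(* The step function of a lies below u. That of b is shifted by one cell: it
   lies above u off the first cell, and its mean is no larger. *)
pose a (k : 'I_n.+1) := u (k.+1%:R / n.+1%:R).
pose b (k : 'I_n.+1) := if k == ord0 then 0 else u (k%:R / n.+1%:R).
have [Xu nu] : X u /\ fs_norm X u <= fs_norm X f.
  apply: (ss_dom sX Xf) => // s s0; rewrite (dfun_rearr (mu := lambda01) mf)//.
  by rewrite ge_min lexx.
have [Xa na] : X (step a) /\ fs_norm X (step a) <= fs_norm X u.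
  apply: (ss_le01 sX Xu); first exact: measurable_step.
  move=> t /andP[t0 t1]; rewrite (ger0_norm (u0 _)).
  have [|k kn tk] := @cell_ex R n t; first by rewrite (ltW t0).
  rewrite (step_cell _ tk)// ger0_norm// /a inordK//.
  apply: (rearr_nonincreasing (mu := lambda01) mf foo) => //; move: tk; rewrite /cell/= in_itv/=.
  by move=> /andP[_ /ltW].
apply: (@le_trans _ _ (n.+1%:R^-1 * \sum_k a k)%:E); last first.
  rewrite lee_fin (le_trans _ nu)// (le_trans _ na)//; apply: ss_step_mean => //.
  by move=> k; exact: u0.
have b0 k : 0 <= b k by rewrite /b; case: ifP.
apply: (@le_trans _ _ (\int[lambda01]_t (step b t)%:E)%E); last first.
  rewrite integral_step// lee_fin ler_pM2l ?invr_gt0// big_ord_recl [leRHS]big_ord_recr/=.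
  have -> : b ord0 = 0 by rewrite /b eqxx.
  rewrite add0r ler_wpDr//; first exact: u0.
have mD : measurable (`[n.+1%:R^-1, 1[%classic : set R) by exact: measurable_itv.
have ms : measurable_fun setT (EFin \o step b).
  by apply/measurable_EFinP; exact: measurable_step.
have s0 t : 0 <= step b t.
  by apply: sumr_ge0 => k _; rewrite mulr_ge0// indicE.
apply: (@le_trans _ _ (\int[lambda01]_(t in `[(n.+1%:R^-1)%R, 1%R[) (step b t)%:E)%E); last first.
  by apply: ge0_subset_integral => // t _; rewrite lee_fin.
apply: ge0_le_integral => //.
- by move=> t _; rewrite lee_fin; exact: u0.
- by apply/measurable_EFinP; exact: measurable_funTS.
- exact: measurable_funTS.
- move=> t /=; rewrite in_itv/= => /andP[t0 t1].
  have t00 : 0 < t by rewrite (lt_le_trans _ t0)// invr_gt0.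
  have [|k kn tk] := @cell_ex R n t; first by rewrite (ltW t00).
  rewrite (step_cell _ tk)// lee_fin /b.
  have k0 : (0 < k)%N.
    move: tk; rewrite lt0n; apply: contraPneq => -> /=.
    by rewrite /cell/= in_itv/= mul1r => /andP[_]; rewrite ltNge t0.
  rewrite ifF; last by apply/negbTE; rewrite -val_eqE/= inordK// -lt0n.
  rewrite inordK//; apply: (rearr_nonincreasing (mu := lambda01) mf foo) => //.
    by rewrite divr_gt0// ltr0n.
  by move: tk; rewrite /cell/= in_itv/= => /andP[].
Qed.

Lemma law_norm_eq (f u : R -> R) : measurable_fun setT f -> measurable_fun setT u ->
  (forall s, 0 <= s -> dfun lambda01 u s = dfun lambda01 f s) ->
  (\int[lambda01]_t (`|f t|)%:E = \int[lambda01]_t (`|u t|)%:E)%E.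
Proof.
move=> mf mu fu.
have mnf : measurable_fun setT (fun t => `|f t|) by exact: measurableT_comp.
have mnu : measurable_fun setT (fun t => `|u t|) by exact: measurableT_comp.
have nE (g : R -> R) : (\int[lambda01]_t (`|g t|)%:E =
    \int[lambda01]_t ((fun y : R => (`|y|%R)%:E) (`|g t|%R)))%E.
  by under [RHS]eq_integral do rewrite normr_id.
rewrite nE [RHS]nE.
apply: (@eq_law_integral _ _ _ _ _ lambda01 lambda01 (fun t => `|f t|)
  (fun t => `|u t|) (fun y : R => (`|y|)%:E)) => //.
- exact: (le_lt_trans (probability_le1 lambda01 measurableT) (ltry _)).
- move=> c; have [c0|c0] := leP 0 c; first exact/esym/fu.
  have E (g : R -> R) : [set x | c < `|g x|] = setT.
    by apply/seteqP; split => // x _ /=; exact: lt_le_trans (normr_ge0 _).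
  by rewrite !E.
- apply/measurable_EFinP.
  have : measurable_fun setT (fun y : R => `|id y|) by apply: measurableT_comp.
  by [].
Qed.

(** The function f and its rearrangement have the same law, and the intervals
    [1/(n+1), 1[ exhaust ]0, 1[. *)
Lemma L1_le_ss (f : R -> R) : X f ->
  (\int[lambda01]_t (`|f t|)%:E <= (fs_norm X f)%:E)%E.
Proof.
move=> Xf; have mf := bfs_measurable bX Xf; have foo := dfun01_fin 0 mf.
pose u := rearr lambda01 f; have u0 t : 0 <= u t by exact: rearr_ge0.
have mu : measurable_fun setT u by exact: (measurable_rearr (mu := lambda01)).
rewrite (@law_norm_eq f u)//; last first.
  move=> s s0; rewrite (dfun_rearr (mu := lambda01) mf)//.
  by apply/min_idPl; exact: dfun01_le1.
under eq_integral do rewrite ger0_norm//.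
pose F n := `[n.+1%:R^-1, 1[%classic : set R.
have mF n : measurable (F n) by exact: measurable_itv.
have mUF : measurable (\bigcup_n F n) by exact: bigcupT_measurable.
have mue : measurable_fun setT (EFin \o u) by exact/measurable_EFinP.
have UFE : \bigcup_n F n = `]0, 1[%classic.
  apply/seteqP; split => t /=; rewrite in_itv/=.
    by move=> [n _]; rewrite /F/= in_itv/= => /andP[t0 ->]; rewrite (lt_le_trans _ t0)// invr_gt0.
  move=> /andP[t0 t1]; have [n] := ltr_add_invr t0; rewrite add0r => nt.
  by exists n => //; rewrite /F/= in_itv/= (ltW nt).
have -> : (\int[lambda01]_t (u t)%:E = \int[lambda01]_(t in \bigcup_n F n) (u t)%:E)%E.
  apply: (etrans (@ge0_negligible_integral _ _ _ lambda01 setT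
    (~` (\bigcup_n F n)) (EFin \o u) _ _ _ _ _)) => //; last first.
  - by rewrite setTD setCK.
  - rewrite UFE; transitivity (lambda01 (set0 : set R)); last exact: measure0.
    apply: lambda01_ext => //; first by apply: measurableC; exact: measurable_itv.
  - by move=> t _; rewrite lee_fin; exact: u0.
  - exact: measurableC.
have cv : (\int[lambda01]_(t in F n) (u t)%:E @[n --> \oo] -->
    \int[lambda01]_(t in \bigcup_n F n) (u t)%:E)%E.
  apply: ge0_nondecreasing_set_cvg_integral => //.
  - move=> m n mn; apply/subsetPset => t; rewrite /F/= !in_itv/= => /andP[t0 ->].
    by rewrite andbT (le_trans _ t0)// lef_pV2 ?posrE// ler_nat ltnS.
  - by move=> n; exact: measurable_funTS.
  - by move=> n t _; rewrite lee_fin.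
rewrite -(cvg_lim _ cv)//; apply: lime_le; first by apply/cvg_ex; eexists; exact: cv.
by apply: nearW => n; exact: ss_riemann.
Qed.

End L1_embedding.

(** * Elementary inequalities *)

Section elementary_bounds.
Context (R : realType).
Implicit Types x u t : R.

Lemma expR_le_quadratic u : expR u <= 1 + u + u ^+ 2 * expR `|u|.
Proof.
have H1 := expR_ge1Dx u; have H2 := expR_ge1Dx (- u).
have e0 : 0 < expR u by exact: expR_gt0.
have H3 : expR u <= 1 + u * expR u.
  have : expR u * (1 - u) <= expR u * expR (- u) by rewrite ler_pM2l.
  by rewrite -expRD subrr expR0; nra.
have [u0|u0] := leP 0 u.
  rewrite ger0_norm//.
  have : u * (expR u - 1) <= u * (u * expR u) by rewrite ler_wpM2l//; lra.
  by nra.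
have e1 : 1 <= expR `|u| by rewrite -expR0 ler_expR.
have : u ^+ 2 * 1 <= u ^+ 2 * expR `|u| by rewrite ler_wpM2l// sqr_ge0.
have : u * (expR u - 1) <= u * u by rewrite ler_wnM2l//; lra.
by rewrite expr2; nra.
Qed.

Lemma expr4_le_expR x : x ^+ 4 <= 256 * (expR x + expR (- x)).
Proof.
have H (y : R) : 0 <= y -> y ^+ 4 <= 256 * expR y.
  move=> y0; have -> : expR y = expR (y / 4) ^+ 4.
    by rewrite -expRM_natl; congr expR; field.
  have H : y / 4 <= expR (y / 4) by have := expR_ge1Dx (y / 4); lra.
  have : (y / 4) ^+ 4 <= expR (y / 4) ^+ 4.
    by rewrite lerXn2r// nnegrE ?expR_ge0// divr_ge0.
  by rewrite expr_div_n; lra.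
have [x0|x0] := leP 0 x.
  by have := H x x0; have := expR_gt0 (- x); lra.
have := H (- x); have -> : (- x) ^+ 4 = x ^+ 4 by ring.
by have := expR_gt0 x; move=> ex /(_ _); rewrite oppr_ge0 ltW// => /(_ isT); lra.
Qed.

Lemma expR1_le4 : expR 1 <= 4 :> R.
Proof.
have H := expR_ge1Dx (- 2^-1 : R).
have -> : expR 1 = expR 2^-1 ^+ 2 :> R.
  by rewrite -expRM_natl; congr expR; field.
have e0 : 0 < expR 2^-1 :> R by exact: expR_gt0.
move: H; rewrite expRN => H.
have : expR 2^-1 <= 2 :> R.
  rewrite -[leLHS]invrK invf_ple ?posrE ?invr_gt0//; lra.
by move=> ?; rewrite expr2; nra.
Qed.

Lemma fact_le_expn (j : nat) : (j`! <= j.+1 ^ j)%N.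
Proof.
elim: j => // j IH; rewrite factS expnS leq_mul//.
by rewrite (leq_trans IH)//; case: j {IH} => // j; rewrite leq_exp2r.
Qed.

Lemma half_le_ln j : (0 < j)%N -> 2^-1 <= ln (1 + j%:R) :> R.
Proof.
move=> j0; rewrite -ler_expR lnK; last by rewrite posrE ltr_pwDl.
have H : expR 2^-1 <= 2 :> R.
  have := expR_ge1Dx (- 2^-1 : R); rewrite expRN => H.
  by rewrite -[leLHS]invrK invf_ple ?posrE ?invr_gt0 ?expR_gt0//; lra.
apply: (le_trans H); rewrite -[leLHS]/(1 + 1) lerD2l ler1n//.
Qed.

(** The Chernoff exponent at level A j, with exp (4 theta) = 1 + j. For A
    large the linear term wins and leaves -j ln (1 + j) - 3, and j! is at most
    (1 + j)^j. *)
Lemma poisson_tail_exponent (C theta A : R) (j : nat) : 0 <= C -> (0 < j)%N ->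
  theta = ln (1 + j%:R) / 4 -> A = 4 * (7 + 4 * C) ->
  2 * expR (theta ^+ 2 * expR (2 * theta) * C - theta * (A * j%:R)) <=
    (expR 1 * j`!%:R)^-1.
Proof.
move=> C0 j0; set l := ln (1 + j%:R) => thl AE.
have j1 : 1 <= j%:R :> R by rewrite ler1n.
have l2 : 2^-1 <= l by exact: half_le_ln.
have th0 : 0 <= theta by rewrite thl; lra.
have el : expR l = 1 + j%:R by rewrite lnK// posrE; lra.
have e4 : expR theta ^+ 4 = 1 + j%:R.
  by rewrite -expRM_natl -el; congr expR; rewrite thl; field.
have th_le : theta <= expR theta by have := expR_ge1Dx theta; lra.
have H1 : theta ^+ 2 * expR (2 * theta) <= 1 + j%:R.
  rewrite -e4 expRM_natl (_ : 4%N = (2 + 2)%N)// exprD ler_wpM2r//; last first.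
    by rewrite lerXn2r// nnegrE ?expR_ge0.
have H2 : theta ^+ 2 * expR (2 * theta) * C - theta * (A * j%:R) <=
    - (j%:R * l) - 3.
  have : theta ^+ 2 * expR (2 * theta) * C <= (1 + j%:R) * C by rewrite ler_wpM2r.
  have jl : 2^-1 <= j%:R * l by nra.
  have : (1 + j%:R) * C <= 4 * (j%:R * l) * C.
    by rewrite ler_wpM2r//; nra.
  have -> : theta * (A * j%:R) = (7 + 4 * C) * (j%:R * l) by rewrite thl AE; field.
  by nra.
have H3 : expR (- (j%:R * l) - 3) <= (8 * (1 + j%:R) ^+ j)^-1 :> R.
  rewrite expRD -mulrN expRM_natl expRN exprVn el invfM mulrC ler_wpM2r//.
  rewrite expRN lef_pV2 ?posrE ?expR_gt0//.
  have : 2 <= expR 1 :> R by have := expR_ge1Dx (1 : R); lra.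
  have -> : expR 3 = expR 1 ^+ 3 :> R by rewrite -expRM_natl mulr1.
  move=> e2; have : 2 ^+ 3 <= expR 1 ^+ 3 :> R by rewrite lerXn2r// nnegrE ?expR_ge0.
  by lra.
apply: (@le_trans _ _ (2 * (8 * (1 + j%:R) ^+ j)^-1)).
  by rewrite ler_pM2l// (le_trans _ H3)// ler_expR.
have F0 : 0 < j`!%:R :> R by rewrite ltr0n fact_gt0.
have F : j`!%:R <= (1 + j%:R) ^+ j :> R.
  by rewrite nat1r -natrX ler_nat fact_le_expn.
rewrite -[X in X * _]invrK -invfM lef_pV2 ?posrE ?mulr_gt0 ?expR_gt0//.
have := expR1_le4; have := expR_gt0 (1 : R).
by nra.
Qed.

End elementary_bounds.

(** * Maximal inequality for bounded independent sums *)

Section bounded_sums.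
Context d (T : measurableType d) (R : realType) (Q : probability T R).

Lemma probability_lty : (Q setT < +oo)%E.
Proof. exact: (le_lt_trans (probability_le1 Q measurableT) (ltry _)). Qed.

Lemma expectation_cst (r : R) : (\int[Q]_w r%:E = r%:E)%E.
Proof.
rewrite integral_cst//; apply: (etrans (congr1 _ (probability_setT Q))).
by rewrite mule1.
Qed.

Lemma bounded_integrable (g : T -> R) (M : R) : measurable_fun setT g ->
  (forall w, `|g w| <= M) -> Q.-integrable setT (EFin \o g).
Proof.
move=> mg gM; apply: measurable_bounded_integrable => //.
  exact: probability_lty.
exists M; split; first exact: num_real.
by move=> x Mx w _ /=; rewrite (le_trans (gM w))// ltW.
Qed.

Lemma measurable_partial_integral (Y : T -> R) (G : R * R -> \bar R) :
  measurable_fun setT Y -> measurable_fun setT G -> (forall p, 0 <= G p)%E ->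
  measurable_fun setT (fun y : R => \int[Q]_w G (y, Y w))%E.
Proof.
move=> mY mG G0; pose G' (p : R * T) := G (p.1, Y p.2).
have mG' : measurable_fun setT G'.
  apply: (measurableT_comp mG); apply: measurable_fun_pair => //.
  exact: (measurableT_comp mY measurable_snd).
exact: (@measurable_fun_fubini_tonelli_F _ _ _ _ _ Q G' mG' (fun p => G0 _)).
Qed.

Section one_variable.
Variables (g : T -> R) (M v : R).
Hypotheses (mg : measurable_fun setT g) (gM : forall w, `|g w| <= M).
Hypothesis g_mean : (\int[Q]_w (g w)%:E = 0)%E.
Hypothesis g_var : (\int[Q]_w (g w ^+ 2)%:E = v%:E)%E.

Lemma integral_quadratic a b c :
  (\int[Q]_w (a + b * g w + c * g w ^+ 2)%:E = (a + c * v)%:E)%E.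
Proof.
have ig : Q.-integrable setT (EFin \o g) by exact: (@bounded_integrable _ M).
have ig2 : Q.-integrable setT (EFin \o (fun w => g w ^+ 2)).
  apply: (@bounded_integrable _ (M ^+ 2)); first exact: measurable_funX.
  by move=> w; rewrite normrX lerXn2r// nnegrE ?normr_ge0// (le_trans _ (gM w)).
have ia : Q.-integrable setT (EFin \o cst a).
  apply: (@bounded_integrable _ `|a|); [exact: measurable_cst|by []].
have ibg := integrableZl measurableT b ig.
have icg := integrableZl measurableT c ig2.
under eq_integral do rewrite 2!EFinD !EFinM.
rewrite integralD//; last exact: integrableD.
rewrite integralD// integralZl// integralZl// g_mean g_var mule0 adde0.
by rewrite expectation_cst -EFinM -EFinD.
Qed.

(** Integrate exp u <= 1 + u + u^2 exp |u|. *)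
Lemma mgf_bound (l : R) :
  (\int[Q]_w (expR (l * g w))%:E <= (expR (l ^+ 2 * expR (`|l| * M) * v))%:E)%E.
Proof.
apply: (@le_trans _ _
    (\int[Q]_w (1 + l * g w + (l ^+ 2 * expR (`|l| * M)) * g w ^+ 2)%:E)%E).
  apply: ge0_le_integral => //.
  - apply/measurable_EFinP; apply: measurableT_comp => //.
    by apply: measurable_funM => //; exact: measurable_cst.
  - apply/measurable_EFinP; apply: measurable_funD.
      apply: measurable_funD; first exact: measurable_cst.
      by apply: measurable_funM => //; exact: measurable_cst.
    apply: measurable_funM; first exact: measurable_cst.
    exact: measurable_funX.
  - move=> w _; rewrite lee_fin (le_trans (expR_le_quadratic _))// lerD2l.
    have p0 : 0 <= l ^+ 2 * g w ^+ 2 by apply: mulr_ge0; exact: sqr_ge0.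
    rewrite [leRHS]mulrAC exprMn (ler_wpM2l p0)//.
    by rewrite ler_expR normrM ler_wpM2l.
by rewrite integral_quadratic lee_fin expR_ge1Dx.
Qed.

End one_variable.

Variables (g : nat -> T -> R) (v : nat -> R) (M : R).
Hypothesis mg : forall k, measurable_fun setT (g k).
Hypothesis ig : indep_seq Q g.
Hypothesis gM : forall k w, `|g k w| <= M.
Hypothesis g_mean : forall k, (\int[Q]_w (g k w)%:E = 0)%E.
Hypothesis g_var : forall k, (\int[Q]_w (g k w ^+ 2)%:E = (v k)%:E)%E.

Let v0 k : 0 <= v k.
Proof. by rewrite -lee_fin -g_var integral_ge0// => w _; rewrite lee_fin sqr_ge0. Qed.

(** One step of the partial sums frozen on entering the set stop; the empty
    set gives the partial sums themselves. *)
Definition stopped_step (stop : R -> bool) (k : nat) (p : R * R) : R :=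
  if stop p.1 then p.1 else p.1 + p.2.

Lemma measurable_stopped_step stop k : measurable_fun setT stop ->
  measurable_fun setT (stopped_step stop k).
Proof.
move=> ms; apply: measurable_fun_ifT.
- exact: (measurableT_comp ms measurable_fst).
- exact: measurable_fst.
- by apply: measurable_funD; [exact: measurable_fst|exact: measurable_snd].
Qed.

(** Each step contributes a factor at least 1, so freezing the walk does not
    spoil the bound for the partial sums. *)
Lemma stopped_mgf stop l k : measurable_fun setT stop ->
  (\int[Q]_w (expR (l * chain g (stopped_step stop) 0 k w))%:E <=
   (expR (l ^+ 2 * expR (`|l| * M) * \sum_(i < k) v i))%:E)%E.
Proof.
move=> ms; have mst k' := measurable_stopped_step k' ms.
elim: k => [|k IH].
  under eq_integral do rewrite /= mulr0 expR0.
  by rewrite expectation_cst big_ord0 mulr0 expR0.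
set q := expR (l ^+ 2 * expR (`|l| * M) * v k).
have q1 : 1 <= q.
  by rewrite -expR0 ler_expR mulr_ge0// mulr_ge0 ?sqr_ge0// expR_ge0.
pose G p := (expR (l * stopped_step stop k p))%:E.
have mG : measurable_fun setT G.
  apply/measurable_EFinP; apply: measurableT_comp => //.
  by apply: measurable_funM => //; exact: measurable_cst.
have mc := measurable_chain mg 0 mst k.
rewrite (_ : (\int[Q]_w _ = \int[Q]_w G (chain g (stopped_step stop) 0 k w, g k w))%E)//.
rewrite (chain_integral mg ig 0 mst)//; last by move=> p; rewrite lee_fin expR_ge0.
have mexp : measurable_fun setT
    (fun w => (expR (l * chain g (stopped_step stop) 0 k w))%:E).
  apply/measurable_EFinP; apply: measurableT_comp => //.
  by apply: measurable_funM => //; exact: measurable_cst.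
apply: (@le_trans _ _ (\int[Q]_w (q%:E * (expR (l * chain g (stopped_step stop) 0 k w))%:E))%E).
  apply: ge0_le_integral => //.
  - by move=> w _; apply: integral_ge0 => w' _; rewrite lee_fin expR_ge0.
  - have G0 p : (0 <= G p)%E by rewrite lee_fin expR_ge0.
    exact: (measurableT_comp (measurable_partial_integral (mg k) mG G0) mc).
  - exact: measurable_funeM.
  - move=> w _; set y := chain _ _ _ _ _; rewrite /G /stopped_step/=.
    case: (stop y).
      rewrite expectation_cst -EFinM lee_fin.
      by rewrite ler_peMl// expR_ge0.
    under eq_integral do rewrite mulrDr expRD EFinM.
    rewrite ge0_integralZl_EFin ?expR_ge0//; last first.
      apply/measurable_EFinP; apply: measurableT_comp => //.
      by apply: measurable_funM => //; exact: measurable_cst.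
    rewrite muleC lee_wpmul2r ?lee_fin ?expR_ge0//.
    exact: mgf_bound.
rewrite ge0_integralZl_EFin//; last by rewrite (le_trans _ q1).
rewrite big_ord_recr/= mulrDr expRD EFinM muleC.
by rewrite lee_wpmul2r// lee_fin expR_ge0.
Qed.

Definition psum k w := \sum_(i < k) g i w.

Lemma chain_psum k w : chain g (stopped_step (fun=> false)) 0 k w = psum k w.
Proof.
by rewrite /psum; elim: k => [|k IH]; rewrite ?big_ord0// big_ord_recr/= -IH.
Qed.

Lemma measurable_psum k : measurable_fun setT (psum k).
Proof. exact: measurable_sum. Qed.

Lemma psum_mgf l k : (\int[Q]_w (expR (l * psum k w))%:E <=
   (expR (l ^+ 2 * expR (`|l| * M) * \sum_(i < k) v i))%:E)%E.
Proof.
under eq_integral do rewrite -chain_psum.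
by apply: stopped_mgf; exact: measurable_cst.
Qed.

Lemma psum_variance k : (\int[Q]_w (psum k w ^+ 2)%:E = (\sum_(i < k) v i)%:E)%E.
Proof.
elim: k => [|k IH].
  by under eq_integral do rewrite /psum big_ord0 expr0n/=; rewrite integral0 big_ord0.
pose G (p : R * R) := ((p.1 + p.2) ^+ 2)%:E.
have mG : measurable_fun setT G.
  apply/measurable_EFinP; apply: measurable_funX.
  by apply: measurable_funD; [exact: measurable_fst|exact: measurable_snd].
have mst k' := @measurable_stopped_step (fun=> false) k' (@measurable_cst _ _ _ _ _ _).
transitivity (\int[Q]_w G (chain g (stopped_step (fun=> false)) 0 k w, g k w))%E.
  by apply: eq_integral => w _; rewrite /G/= chain_psum /psum big_ord_recr.
rewrite (chain_integral mg ig 0 mst)//; last by move=> p; rewrite lee_fin sqr_ge0.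
transitivity (\int[Q]_w ((psum k w ^+ 2)%:E + (v k)%:E))%E.
  apply: eq_integral => w _; rewrite chain_psum /G/=.
  rewrite -EFinD -[v k]mul1r.
  rewrite -(integral_quadratic (mg k) (gM k) (g_mean k) (g_var k) _ (2 * psum k w)).
  by apply: eq_integral => u _; congr (_%:E); ring.
rewrite ge0_integralD//.
- by rewrite IH expectation_cst big_ord_recr.
- by move=> w _; rewrite lee_fin sqr_ge0.
- by apply/measurable_EFinP; apply: measurable_funX; exact: measurable_psum.
- by move=> _ _; rewrite lee_fin.
Qed.

Let L : R := 1024 * expR (expR 1).

(** If the standard deviation s were large compared with D, it would exceed M,
    and the fourth moment, read off the moment generating function at 1/s,
    would be O(s^4). The first absolute moment would then be at least of order
    s. *)
Lemma variance_bound n (D : R) : 0 < D -> M <= 2 * D ->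
  (\int[Q]_w `|psum n w|%:E <= (2 * D)%:E)%E ->
  \sum_(i < n) v i <= (4 * L) ^+ 2 * D ^+ 2.
Proof.
move=> D0 MD SD; set s2 := \sum_(i < n) v i.
rewrite leNgt; apply/negP => big.
have K1 : 1 <= expR (expR 1) :> R by rewrite -expR0 ler_expR expR_ge0.
have L1 : 1024 <= L by rewrite /L; lra.
have s20 : 0 <= s2 by exact: sumr_ge0.
pose s := Num.sqrt s2; have ss : s ^+ 2 = s2 by rewrite sqr_sqrtr.
have sLD : 4 * L * D < s.
  rewrite -(@ltr_pXn2r _ 2%N)// ?nnegrE ?sqrtr_ge0//.
    by rewrite ss exprMn.
  by rewrite mulr_ge0 ?(ltW D0)// mulr_ge0//; lra.
have s0 : 0 < s by rewrite (le_lt_trans _ sLD)// mulr_ge0 ?(ltW D0)// mulr_ge0//; lra.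
have Ms : M <= s by nra.
(* Use x^2 <= a |x| + x^4 / a^2 for a = L s: the last term has mean at most
   s^2 / (2 L), so at least half of s^2 is bounded by 2 L s D. *)
have [a aE] : {a | a = L * s} by exists (L * s).
have a0 : 0 < a by rewrite aE mulr_gt0//; lra.
have mgfs l : `|l| = s^-1 -> (\int[Q]_w (expR (l * psum n w))%:E <= (expR (expR 1))%:E)%E.
  move=> ls; apply: (le_trans (psum_mgf l n)); rewrite lee_fin ler_expR -/s2.
  have -> : l ^+ 2 = (s2)^-1 by rewrite -[l ^+ 2]ger0_norm ?sqr_ge0// normrX ls exprVn ss.
  rewrite mulrAC mulVf ?mul1r ?ler_expR ?ls; last by rewrite -ss expf_eq0/= gt_eqF.
  by rewrite mulrC ler_pdivrMr ?mul1r.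
have mS := measurable_psum n.
have mexp l : measurable_fun setT (fun w => (expR (l * psum n w))%:E).
  apply/measurable_EFinP; apply: measurableT_comp => //.
  by apply: measurable_funM => //; exact: measurable_cst.
have [C4 C4E] : {C4 | C4 = 256 * s ^+ 4 / a ^+ 2} by eexists.
have C40 : 0 <= C4 by rewrite C4E; apply: divr_ge0; [exact: (mulr_ge0 (ler0n _ _) (exprn_ge0 4 (ltW s0)))|exact: sqr_ge0].
have pw w : psum n w ^+ 2 <= a * `|psum n w| +
    C4 * (expR (s^-1 * psum n w) + expR (- s^-1 * psum n w)).
  set x := psum n w.
  have H4 : x ^+ 4 <= 256 * s ^+ 4 * (expR (s^-1 * x) + expR (- s^-1 * x)).
    have := expr4_le_expR (s^-1 * x); rewrite mulNr exprMn exprVn.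
    rewrite mulrC -ler_pdivlMr; last by rewrite invr_gt0 exprn_gt0.
    by rewrite invrK; nra.
  have e0 : 0 <= expR (s^-1 * x) + expR (- s^-1 * x) by rewrite addr_ge0 ?expR_ge0.
  have [xa|ax] := leP `|x| a.
    have : x ^+ 2 <= a * `|x| by rewrite -[x ^+ 2]ger0_norm ?sqr_ge0// normrX expr2 ler_wpM2r.
    by have := mulr_ge0 C40 e0; lra.
  have : x ^+ 2 <= C4 * (expR (s^-1 * x) + expR (- s^-1 * x)).
    rewrite C4E mulrAC ler_pdivlMr ?exprn_gt0//; apply: le_trans H4.
    rewrite (_ : 4%N = (2 + 2)%N)// exprD ler_wpM2l ?sqr_ge0//.
    rewrite -[leRHS]ger0_norm ?sqr_ge0// normrX lerXn2r ?nnegrE// ltW//.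
  by have := mulr_ge0 (ltW a0) (normr_ge0 x); lra.
have : (s2%:E <= (a * (2 * D) + C4 * (expR (expR 1) + expR (expR 1)))%:E)%E.
  rewrite -psum_variance.
  apply: (@le_trans _ _ (\int[Q]_w (a%:E * `|psum n w|%:E +
     C4%:E * ((expR (s^-1 * psum n w))%:E + (expR (- s^-1 * psum n w))%:E)))%E).
    apply: ge0_le_integral => //.
    - by move=> w _; rewrite lee_fin sqr_ge0.
    - by apply/measurable_EFinP; exact: measurable_funX.
    - apply: emeasurable_funD; apply: measurable_funeM.
        by apply/measurable_EFinP; exact: measurableT_comp.
      exact: emeasurable_funD.
    - by move=> w _; have := pw w; rewrite -lee_fin EFinD !EFinM EFinD.
  have mabs : measurable_fun setT (fun w => `|psum n w|%:E).
    by apply/measurable_EFinP; exact: measurableT_comp.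
  rewrite ge0_integralD//; last 4 first.
  - by move=> w _; rewrite -EFinM lee_fin mulr_ge0// ltW.
  - exact: measurable_funeM.
  - by move=> w _; rewrite -EFinD -EFinM lee_fin mulr_ge0// addr_ge0 ?expR_ge0.
  - by apply: measurable_funeM; exact: emeasurable_funD.
  rewrite EFinD (EFinM a) (EFinM C4); apply: leeD.
    rewrite (ge0_integralZl_EFin _ measurableT _ mabs (ltW a0))//.
    by apply: lee_wpmul2l => //; rewrite lee_fin ltW.
  rewrite (ge0_integralZl_EFin _ measurableT _ (emeasurable_funD (mexp _) (mexp _)) C40)//; last first.
    by move=> w _; rewrite -EFinD lee_fin addr_ge0 ?expR_ge0.
  apply: lee_wpmul2l; first by rewrite lee_fin.
  rewrite ge0_integralD//; [|by move=> w _; rewrite lee_fin expR_ge0..].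
  have sV : `|s^-1| = s^-1 by rewrite gtr0_norm// invr_gt0.
  by rewrite EFinD; apply: leeD; apply: mgfs; rewrite ?normrN.
rewrite lee_fin -ss C4E aE => H.
have K : expR (expR 1) = L / 1024 by rewrite /L; field.
have E : 256 * s ^+ 4 / (L * s) ^+ 2 * (expR (expR 1) + expR (expR 1)) = s ^+ 2 / (2 * L).
  by rewrite K; field; rewrite !lt0r_neq0//; lra.
rewrite E in H.
have : s ^+ 2 / (2 * L) <= s ^+ 2 / 2.
  by rewrite ler_wpM2l ?sqr_ge0// lef_pV2 ?posrE; lra.
by nra.
Qed.

(** The constant A of the Chernoff exponent for C = (4 L)^2, the variance
    bound in units of D^2. *)
Definition tail_constant : R := 4 * (7 + 4 * (4 * L) ^+ 2).

Lemma tail_constant_gt0 : 0 < tail_constant.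
Proof. by rewrite mulr_gt0// ltr_pwDl// mulr_ge0// sqr_ge0. Qed.

(** A walk stopped on leaving [-x, x] remembers at time n that it has left. *)
Lemma stopped_exceeds (x : R) n w : 0 <= x ->
  (exists2 k, (k <= n)%N & x < `|psum k w|) ->
  x < `|chain g (stopped_step (fun y => x < `|y|)) 0 n w|.
Proof.
move=> x0; set Y := chain _ _ _.
have : x < `|Y n w| \/ (Y n w = psum n w /\ forall k, (k <= n)%N -> `|psum k w| <= x).
  elim: n => [|n [IH|[IH1 IH2]]].
  - right; split; first by rewrite /psum big_ord0.
    by move=> k; rewrite leqn0 => /eqP ->; rewrite /psum big_ord0 normr0.
  - by left; rewrite /Y /= -/Y /stopped_step /= IH.
  - have E : Y n.+1 w = psum n.+1 w.
      by rewrite /Y /= -/Y /stopped_step /= IH1 ltNge IH2// /psum big_ord_recr.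
    have [H|H] := ltP x `|psum n.+1 w|; first by left; rewrite E.
    right; split => // k; rewrite leq_eqVlt ltnS => /orP[/eqP ->//|]; exact: IH2.
move=> [//|[_ H]] [k kn]; rewrite ltNge H//.
Qed.

Lemma measurable_exceeds n (x : R) :
  measurable [set w | exists2 k, (k <= n)%N & x < `|psum k w|].
Proof.
rewrite (_ : [set w | _] = \bigcup_(k in [set k | (k <= n)%N]) [set w | x < `|psum k w|]).
  by apply: bigcup_measurable => k _; apply: measurable_superlevel; exact: measurable_psum.
by apply/seteqP; split => w /= [k]; exists k.
Qed.

(** Chernoff bound for the walk stopped on leaving an interval. The right-hand
    side is the measure of the j-th set of a Kruglov partition. *)
Lemma maximal_tail n (D : R) (j : nat) : 0 < D -> M <= 2 * D ->
  (\int[Q]_w `|psum n w|%:E <= (2 * D)%:E)%E -> (0 < j)%N ->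
  (Q [set w | exists2 k, (k <= n)%N & (tail_constant * j%:R * D < `|psum k w|)%R] <=
   ((expR 1 * j`!%:R)^-1)%:E)%E.
Proof.
move=> D0 MD SD j0; set x := tail_constant * j%:R * D.
have x0 : 0 <= x by rewrite mulr_ge0 ?(ltW D0)// mulr_ge0// ltW// tail_constant_gt0.
pose stop (y : R) := x < `|y|.
have ms : measurable_fun setT stop.
  apply: measurable_fun_ltr; first exact: measurable_cst.
  by have : measurable_fun setT (fun y : R => `|id y|) by apply: measurableT_comp.
have mst k' := measurable_stopped_step k' ms.
pose Y := chain g (stopped_step stop) 0 n.
have mY : measurable_fun setT Y by exact: measurable_chain.
pose theta : R := ln (1 + j%:R) / 4; pose l := theta / D.
have th0 : 0 <= theta by rewrite divr_ge0// ln_ge0// lerDl.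
have l0 : 0 <= l by rewrite divr_ge0// ltW.
set C := (4 * L) ^+ 2.
have mgfY r : `|r| = l ->
    (\int[Q]_w (expR (r * Y w))%:E <= (expR (theta ^+ 2 * expR (2 * theta) * C))%:E)%E.
  move=> rl; apply: (le_trans (stopped_mgf r n ms)); rewrite lee_fin ler_expR.
  have -> : r ^+ 2 = l ^+ 2 by rewrite -[r ^+ 2]ger0_norm ?sqr_ge0// normrX rl.
  rewrite rl; apply: (@le_trans _ _ (l ^+ 2 * expR (l * M) * (C * D ^+ 2))).
    apply: ler_wpM2l; last exact: variance_bound.
    by apply: mulr_ge0; [exact: sqr_ge0|exact: expR_ge0].
  have -> : l ^+ 2 * expR (l * M) * (C * D ^+ 2) = theta ^+ 2 * expR (l * M) * C.
    by rewrite /l; field; exact: lt0r_neq0.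
  rewrite ler_wpM2r ?sqr_ge0// ler_wpM2l ?sqr_ge0// ler_expR.
  apply: (@le_trans _ _ (l * (2 * D))); first by rewrite ler_wpM2l.
  by rewrite /l le_eqVlt; apply/orP; left; apply/eqP; field; exact: lt0r_neq0.
have mexp r : measurable_fun setT (fun w => (expR (r * Y w))%:E).
  apply/measurable_EFinP; apply: measurableT_comp => //.
  by apply: measurable_funM => //; exact: measurable_cst.
have mE : measurable [set w | x < `|Y w|] by exact: measurable_superlevel.
apply: (@le_trans _ _ (Q [set w | x < `|Y w|])).
  apply: le_measure; rewrite ?inE//; first exact: measurable_exceeds.
  by move=> w /=; exact: stopped_exceeds.
rewrite -[X in Q X]setIT -integral_indic//.
apply: (@le_trans _ _ (\int[Q]_w ((expR (- (l * x)))%:E *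
    ((expR (l * Y w))%:E + (expR (- l * Y w))%:E)))%E).
  apply: ge0_le_integral => //.
  - by apply/measurable_EFinP; exact: measurable_indic.
  - by apply: measurable_funeM; exact: emeasurable_funD.
  - move=> w _; rewrite -EFinD -EFinM lee_fin indicE.
    have [/[!inE]/= H|_] := boolP (w \in _); last first.
      by rewrite mulr_ge0 ?addr_ge0 ?expR_ge0.
    rewrite mulrDr -!expRD.
    have e1 := expR_gt0 (- (l * x) + l * Y w).
    have e2 := expR_gt0 (- (l * x) + - l * Y w).
    have [y0|y0] := leP 0 (Y w).
      have : expR 0 <= expR (- (l * x) + l * Y w).
        rewrite ler_expR; move: H; rewrite ger0_norm//; nra.
      by rewrite expR0; lra.
    have : expR 0 <= expR (- (l * x) + - l * Y w).
      by rewrite ler_expR; move: H; rewrite ltr0_norm//; nra.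
    by rewrite expR0; lra.
rewrite ge0_integralZl_EFin ?expR_ge0//; last 2 first.
- by move=> w _; rewrite -EFinD lee_fin addr_ge0 ?expR_ge0.
- exact: emeasurable_funD.
rewrite ge0_integralD//; [|idtac..].
apply: (@le_trans _ _ ((expR (- (l * x)))%:E *
   ((expR (theta ^+ 2 * expR (2 * theta) * C))%:E +
    (expR (theta ^+ 2 * expR (2 * theta) * C))%:E))%E).
  rewrite lee_wpmul2l// ?lee_fin ?expR_ge0// leeD// mgfY//.
    by rewrite ger0_norm.
  by rewrite normrN ger0_norm.
rewrite -EFinD -EFinM lee_fin.
apply: le_trans (@poisson_tail_exponent R C theta tail_constant j _ j0 erefl erefl); last first.
  exact: sqr_ge0.
have -> : l * x = theta * (tail_constant * j%:R).
  by rewrite /l /x; field; exact: lt0r_neq0.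
rewrite le_eqVlt; apply/orP; left; apply/eqP.
by rewrite expRD; ring.
Qed.

End bounded_sums.

(** * Positive operators on Borel functions *)

Section positive_operators.
Context (R : realType).
Local Open Scope ereal_scope.
Implicit Types (G H : R -> \bar R) (T U : (R -> \bar R) -> R -> \bar R).

(** On these functions convolution operators act without integrability
    conditions and commute by Tonelli. *)
Definition nnborel G : Prop := measurable_fun setT G /\ forall x, 0 <= G x.

Record positive_operator T : Prop := PositiveOperator {
  po_nnborel : forall G, nnborel G -> nnborel (T G) ;
  po_add : forall G H x, nnborel G -> nnborel H ->
    T (fun y => G y + H y) x = T G x + T H x ;
  po_scale : forall (c : R) G x, (0 <= c)%R -> nnborel G ->
    T (fun y => c%:E * G y) x = c%:E * T G x ;
  po_le : forall G H, nnborel G -> nnborel H ->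
    (forall x, G x <= H x) -> forall x, T G x <= T H x }.

Definition add_op T U G x := T G x + U G x.

Definition commuting T U : Prop := forall G, nnborel G -> T (U G) = U (T G).

Lemma nnborelD G H : nnborel G -> nnborel H -> nnborel (fun x => G x + H x).
Proof.
move=> [mG G0] [mH H0]; split; first exact: emeasurable_funD.
by move=> x; apply: adde_ge0.
Qed.

Lemma nnborelZ (c : R) G : (0 <= c)%R -> nnborel G -> nnborel (fun x => c%:E * G x).
Proof.
move=> c0 [mG G0]; split; first exact: measurable_funeM.
by move=> x; apply: mule_ge0.
Qed.

Lemma positive_add_op T U : positive_operator T -> positive_operator U ->
  positive_operator (add_op T U).
Proof.
move=> pT pU; split.
- move=> G nG; apply: nnborelD; exact: po_nnborel.
- by move=> G H x nG nH; rewrite /add_op !po_add// addeACA.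
- move=> c G x c0 nG; rewrite /add_op !po_scale// ge0_muleDr//.
    by case: (po_nnborel pT nG).
  by case: (po_nnborel pU nG).
- by move=> G H nG nH GH x; apply: leeD; apply: po_le.
Qed.

Lemma nnborel_iter T m G : positive_operator T -> nnborel G -> nnborel (iter m T G).
Proof. by move=> pT nG; elim: m => //= m IH; exact: po_nnborel. Qed.

Lemma commuting_iter T U m G : positive_operator U -> commuting T U -> nnborel G ->
  T (iter m U G) = iter m U (T G).
Proof.
move=> pU TU nG; elim: m => //= m IH; rewrite TU ?IH//; exact: nnborel_iter.
Qed.

Lemma commuting_add_op T U V : positive_operator T ->
  positive_operator U -> positive_operator V ->
  commuting T U -> commuting T V -> commuting T (add_op U V).
Proof.
move=> pT pU pV TU TV G nG; apply/funext => x.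
rewrite /add_op -TU// -TV// [LHS](po_add pT)//; exact: po_nnborel.
Qed.

Lemma iter_le T U m G : positive_operator T -> positive_operator U ->
  (forall H, nnborel H -> forall x, T H x <= U H x) -> nnborel G ->
  forall x, iter m T G x <= iter m U G x.
Proof.
move=> pT pU TU nG; elim: m => //= m IH x.
apply: (le_trans (TU _ (nnborel_iter m pT nG) x)).
by apply: po_le => //; exact: nnborel_iter.
Qed.

(** The first two terms of the binomial formula; by positivity the others can
    be dropped. *)
Lemma iter_add_op_ge T U m G : positive_operator T -> positive_operator U ->
  commuting T U -> nnborel G -> forall x,
  iter m.+1 U G x + m.+1%:R%:E * T (iter m U G) x <= iter m.+1 (add_op U T) G x.
Proof.
move=> pT pU TU nG; have pUT := positive_add_op pU pT.
elim: m => [|m IH] x; first by rewrite mul1e.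
set A := iter m.+1 U G.
have nA : nnborel A by exact: nnborel_iter.
have nm : nnborel (iter m U G) by exact: nnborel_iter.
have nB : nnborel (fun y => A y + m.+1%:R%:E * T (iter m U G) y).
  by apply: nnborelD => //; apply: nnborelZ => //; exact: po_nnborel.
apply: le_trans (po_le pUT nB (nnborel_iter m.+1 pUT nG) IH x).
have nTm := po_nnborel pT nm.
have nZ := nnborelZ (ler0n R m.+1) nTm.
rewrite /add_op !po_add// !po_scale// -(TU _ nm).
have -> : U (iter m U G) = A by [].
have -> : iter m.+2 U G x = U A x by [].
have := (po_nnborel pT nA).2 x; have := (po_nnborel pT nTm).2 x.
set a := U A x; set b := T A x; set c := T (T _) x => c0 b0.
rewrite -addeA leeD2l// -[leLHS]adde0.
have -> : m.+2%:R%:E * b = m.+1%:R%:E * b + b.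
  by rewrite -natr1 EFinD ge0_muleDl// mul1e.
by rewrite addeA leeD// mule_ge0.
Qed.

(** The exponential series of T cut after k terms. Poissonizing a sum of
    independent variables turns its law into such a series. *)
Definition exp_trunc k T G x := \sum_(m < k.+1) (m`!%:R^-1)%:E * iter m T G x.

Lemma inv_fact_ge0 m : (0 <= m`!%:R^-1 :> R)%R.
Proof. by rewrite invr_ge0. Qed.

(** Termwise, by the binomial formula: T U^m / m! is absorbed by (m + 1) T U^m
    / (m + 1)!. *)
Lemma exp_trunc_step k T U G x : positive_operator T -> positive_operator U ->
  commuting T U -> nnborel G ->
  exp_trunc k U (fun y => G y + T G y) x <= exp_trunc k.+1 (add_op U T) G x.
Proof.
move=> pT pU TU nG; have nTG := po_nnborel pT nG.
have n0 (m : nat) : (0 <= (m`!%:R^-1 : R)%:E)%E by rewrite lee_fin inv_fact_ge0.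
have itD m : iter m U (fun y => G y + T G y) x = iter m U G x + T (iter m U G) x.
  rewrite (commuting_iter m pU TU nG).
  elim: m x => // m IH x /=.
  have -> : iter m U (fun y => G y + T G y) = fun y => iter m U G y + iter m U (T G) y.
    by apply/funext => y; exact: IH.
  by rewrite po_add//; exact: nnborel_iter.
rewrite /exp_trunc.
under eq_bigr do rewrite itD ge0_muleDr// ?(nnborel_iter _ pU nG).2 ?(po_nnborel pT (nnborel_iter _ pU nG)).2//.
rewrite big_split/= [leRHS]big_ord_recl/=.
apply: (@le_trans _ _ (\sum_(m < k.+2) (m`!%:R^-1)%:E * iter m U G x +
   \sum_(m < k.+1) (m`!%:R^-1)%:E * T (iter m U G) x)).
  rewrite leeD2r// [leRHS]big_ord_recr/= leeDl// mule_ge0//.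
  by case: (po_nnborel pU (nnborel_iter k pU nG)).
rewrite big_ord_recl/= -addeA leeD2l// -big_split/=; apply: lee_sum => m _.
rewrite /bump leq0n add1n !add0n.
have nU := po_nnborel pU (nnborel_iter m pU nG).
have nT := po_nnborel pT (nnborel_iter m pU nG).
have E : (m`!%:R^-1)%:E = ((m.+1)`!%:R^-1)%:E * m.+1%:R%:E :> \bar R.
  by rewrite -EFinM factS natrM invfM mulrAC mulVf ?mul1r.
apply: (@le_trans _ _ (((m.+1)`!%:R^-1)%:E *
    (iter m.+1 U G x + m.+1%:R%:E * T (iter m U G) x))).
  rewrite ge0_muleDr; [by rewrite muleA -E|exact: (nU.2 x)|].
  by apply: mule_ge0 => //; exact: (nT.2 x).
by apply: lee_wpmul2l; [exact: n0|exact: iter_add_op_ge].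
Qed.

End positive_operators.

(** * Sums of large values *)

Section sums_of_large_values.
Context d (T : measurableType d) (R : realType) (Q : probability T R).
Variables (g : nat -> T -> R) (s0 : R).
Hypothesis mg : forall k, measurable_fun setT (g k).
Hypothesis ig : indep_seq Q g.
Local Open Scope ereal_scope.

Definition large_part (c : R) : R := if (s0 < `|c|)%R then `|c|%R else 0%R.

Lemma measurable_large_part : measurable_fun setT large_part.
Proof.
have mn : measurable_fun setT (fun y : R => `|id y|%R) by apply: measurableT_comp.
apply: measurable_fun_ifT => //; first exact: measurable_fun_ltr.
Qed.

Definition jump_kernel (G : R -> \bar R) (p : R * R) : \bar R :=
  if (s0 < `|p.2|)%R then G (p.1 + `|p.2|)%R else 0.

(** Convolution with the law of |g k| restricted to the values above s0. *)
Definition jump_op k (G : R -> \bar R) (x : R) : \bar R :=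
  \int[Q]_w jump_kernel G (x, g k w).

Lemma measurable_jump_kernel G : measurable_fun setT G ->
  measurable_fun setT (jump_kernel G).
Proof.
move=> mG.
have mn : measurable_fun setT (fun p : R * R => `|p.2|%R).
  by apply: measurableT_comp => //; exact: measurable_snd.
apply: measurable_fun_ifT.
- exact: measurable_fun_ltr.
- apply: (measurableT_comp mG); apply: measurable_funD => //; exact: measurable_fst.
- exact: measurable_cst.
Qed.

Let mjump k G x : measurable_fun setT G ->
  measurable_fun setT (fun w => jump_kernel G (x, g k w)).
Proof.
move=> mG; have mp : measurable_fun setT (fun w => (x, g k w)).
  by apply: measurable_fun_pair => //; exact: measurable_cst.
exact: (measurableT_comp (measurable_jump_kernel mG) mp).
Qed.

Let jump0 (G : R -> \bar R) p : (forall y, 0 <= G y) -> 0 <= jump_kernel G p.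
Proof. by move=> G0; rewrite /jump_kernel; case: ifP. Qed.

Lemma positive_jump_op k : positive_operator (jump_op k).
Proof.
split.
- move=> G [mG G0]; split; last by move=> x; apply: integral_ge0 => w _; exact: jump0.
  apply: (measurable_partial_integral Q (mg k) (measurable_jump_kernel mG)).
  by move=> p; exact: jump0.
- move=> G H x [mG G0] [mH H0]; rewrite /jump_op -ge0_integralD//.
  + by apply: eq_integral => w _; rewrite /jump_kernel; case: ifP => //; rewrite adde0.
  + by move=> w _; exact: jump0.
  + exact: mjump.
  + by move=> w _; exact: jump0.
  + exact: mjump.
- move=> c G x c0 [mG G0]; rewrite /jump_op -ge0_integralZl_EFin//.
  + by apply: eq_integral => w _; rewrite /jump_kernel; case: ifP => //; rewrite mule0.
  + by move=> w _; exact: jump0.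
  + exact: mjump.
- move=> G H [mG G0] [mH H0] GH x; apply: ge0_le_integral => //.
  + by move=> w _; exact: jump0.
  + exact: mjump.
  + exact: mjump.
  + by move=> w _; rewrite /jump_kernel; case: ifP.
Qed.

Lemma commuting_jump_op k l : commuting (jump_op k) (jump_op l).
Proof.
move=> G [mG G0]; apply/funext => x; rewrite /jump_op.
pose F (p : T * T) := if (s0 < `|g k p.1|)%R then
  (if (s0 < `|g l p.2|)%R then G (x + `|g k p.1| + `|g l p.2|)%R else 0) else 0.
have mF : measurable_fun setT F.
  have m1 : measurable_fun setT (fun p : T * T => `|g k p.1|%R).
    by apply: measurableT_comp => //; apply: (measurableT_comp (mg k)); exact: measurable_fst.
  have m2 : measurable_fun setT (fun p : T * T => `|g l p.2|%R).
    by apply: measurableT_comp => //; apply: (measurableT_comp (mg l)); exact: measurable_snd.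
  apply: measurable_fun_ifT; [exact: measurable_fun_ltr| |exact: measurable_cst].
  apply: measurable_fun_ifT; [exact: measurable_fun_ltr| |exact: measurable_cst].
  apply: (measurableT_comp mG); apply: measurable_funD => //.
  by apply: measurable_funD => //; exact: measurable_cst.
have F0 p : 0 <= F p by rewrite /F; case: ifP => // _; case: ifP.
have := @fubini_tonelli _ _ _ _ _ Q Q F mF F0.
under eq_integral => w _.
  have -> : \int[Q]_y F (w, y) = (if (s0 < `|g k w|)%R then jump_op l G (x + `|g k w|) else 0).
    by rewrite /F/= /jump_op /jump_kernel/=; case: ifP => // _; rewrite integral0.
  over.
rewrite {1}/jump_kernel/= => ->; apply: eq_integral => w _; rewrite /F /jump_kernel/=.
case: ifP => lw; last by under eq_integral do rewrite if_same; rewrite integral0.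
by apply: eq_integral => v _; case: ifP => // _; rewrite addrAC.
Qed.

Fixpoint total_jump_op k : (R -> \bar R) -> R -> \bar R :=
  if k is k'.+1 then add_op (total_jump_op k') (jump_op k') else fun _ _ => 0.

Lemma positive_total_jump_op k : positive_operator (total_jump_op k).
Proof.
elim: k => [|k IH] /=; last exact: (positive_add_op IH (positive_jump_op k)).
split => //=.
- by move=> *; rewrite adde0.
- by move=> *; rewrite mule0.
Qed.

Lemma commuting_total_jump_op l k : commuting (jump_op l) (total_jump_op k).
Proof.
elim: k => [|k IH] /=.
  move=> G [mG G0]; apply/funext => x; rewrite /jump_op /jump_kernel.
  by under eq_integral do rewrite if_same; rewrite integral0.
apply: commuting_add_op; [exact: positive_jump_op|
  exact: positive_total_jump_op|exact: positive_jump_op|exact: IH|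
  exact: commuting_jump_op].
Qed.

Lemma total_jump_opE k G x : total_jump_op k G x = \sum_(i < k) jump_op i G x.
Proof.
by elim: k => [|k IH] /=; rewrite ?big_ord0// big_ord_recr/= -IH.
Qed.

(** Adding one variable replaces G by at most G + T_k G, where T_k is its jump
    operator: the event that the variable is small has probability at most 1.
    The factor 1 + T_k is then absorbed in the exponential series. *)
Lemma sum_large_le k G x : nnborel G ->
  \int[Q]_w G (x + \sum_(i < k) large_part (g i w))%R <=
    exp_trunc k (total_jump_op k) G x.
Proof.
pose step (_ : nat) (p : R * R) : R := (p.1 + large_part p.2)%R.
have mstep k' : measurable_fun setT (step k').
  apply: measurable_funD; first exact: measurable_fst.
  exact: (measurableT_comp measurable_large_part measurable_snd).
have chainE l w : chain g step x l w = (x + \sum_(i < l) large_part (g i w))%R.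
  elim: l => [|l IH] /=; first by rewrite big_ord0 addr0.
  by rewrite /step/= IH big_ord_recr/= addrA.
elim: k G => [|k IH] G nG.
  under eq_integral do rewrite big_ord0 addr0.
  rewrite /exp_trunc big_ord_recl big_ord0 adde0/= fact0 invr1 mul1e.
  rewrite integral_cst//; apply: (@le_trans _ _ (G x * 1)); last by rewrite mule1.
  by apply: lee_wpmul2l; [case: nG|exact: probability_le1].
have [mG G0] := nG.
pose H (p : R * R) := G (step 0%N p).
have mH : measurable_fun setT H by exact: (measurableT_comp mG (mstep 0%N)).
have -> : \int[Q]_w G (x + \sum_(i < k.+1) large_part (g i w))%R =
    \int[Q]_w H (chain g step x k w, g k w).
  by apply: eq_integral => w _; rewrite /H /step/= chainE big_ord_recr/= addrA.
rewrite (chain_integral mg ig x mstep k mH); last by move=> p; exact: G0.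
apply: le_trans (exp_trunc_step k x (positive_jump_op k) (positive_total_jump_op k)
  (commuting_total_jump_op k k) nG).
have nGT := nnborelD nG (po_nnborel (positive_jump_op k) nG).
apply: le_trans (IH _ nGT).
have mc := measurable_chain mg x mstep k.
apply: ge0_le_integral => //.
- by move=> w _; apply: integral_ge0 => v _; exact: G0.
- exact: (measurableT_comp (measurable_partial_integral Q (mg k) mH (fun p => G0 _)) mc).
- apply: (measurableT_comp nGT.1).
  by under eq_fun do rewrite -chainE.
move=> w _; rewrite chainE; set y := (x + _)%R.
rewrite /jump_op.
apply: (@le_trans _ _ (\int[Q]_v (G y + jump_kernel G (y, g k v)))).
  apply: ge0_le_integral => //.
  - by move=> v _; exact: G0.
  - apply: (measurableT_comp mH); apply: measurable_fun_pair => //; exact: measurable_cst.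
  - by apply: emeasurable_funD; [exact: measurable_cst|exact: mjump].
  - move=> v _; rewrite /H /step/= /large_part /jump_kernel/=.
    by case: ifP => _; [rewrite leeDr|rewrite addr0 adde0].
rewrite ge0_integralD//; [|by move=> v _; exact: jump0|exact: mjump].
rewrite leeD2r// integral_cst//; apply: (@le_trans _ _ (G y * 1)); last by rewrite mule1.
by apply: lee_wpmul2l => //; exact: probability_le1.
Qed.

End sums_of_large_values.

(** * The product space *)

Definition coord {R : realType} (k : nat) (w : Omega R) : R := w k.

Section product_space.
Context (R : realType) (P : probability (Omega R) R).
Hypothesis hP : is_product_measure P.

Lemma measurable_coord k : measurable_fun setT (coord k : Omega R -> R).
Proof.
move=> _ A mA; rewrite setTI; apply: sub_sigma_algebra; by exists k, A.
Qed.

Lemma coord_law k (A : set R) : measurable A -> P (coord k @^-1` A) = lambda01 A.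
Proof.
move=> mA; pose C j : set R := if j == k then A else setT.
have mC j : measurable (C j) by rewrite /C; case: ifP.
have := hP k.+1 mC.
have -> : [set w : Omega R | forall j, (j < k.+1)%N -> C j (w j)] = coord k @^-1` A.
  apply/seteqP; split => w /=.
    by move=> /(_ k (ltnSn k)); rewrite /C eqxx.
  by move=> Aw j _; rewrite /C; case: ifPn => // /eqP ->.
move=> ->; rewrite big_ord_recr/= big1 ?mul1e /C ?eqxx// => j _.
by rewrite ltn_eqF ?ltn_ord//; exact: (@probability_setT _ _ _ lambda01).
Qed.

Lemma indep_coord : indep_seq P coord.
Proof.
move=> n A mA; rewrite [LHS]hP//; apply: eq_bigr => k _.
by rewrite coord_law.
Qed.

Lemma coord_integral k (F : R -> \bar R) : measurable_fun setT F ->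
  (forall t, 0 <= F t)%E ->
  (\int[P]_w F (coord k w) = \int[lambda01]_t F t)%E.
Proof.
move=> mF F0.
have mc : measurable_fun setT (coord k : Omega R -> measurableTypeR R).
  exact: measurable_coord.
apply: (etrans (esym (ge0_integral_pushforward mc P measurableT _ _))) => //.
by apply: eq_measure_integral => A mA _; exact: coord_law.
Qed.

End product_space.

(** * The distribution of the Kruglov operator *)

Section kruglov_operator.
Context (R : realType) (P : probability (Omega R) R) (B : nat -> set R).
Hypothesis hP : is_product_measure P.
Hypothesis hB : kruglov_partition B.

Lemma measurable_partition n : (0 < n)%N -> measurable (B n).
Proof. by case: hB => H _ _ /H[]. Qed.

Lemma lambda01_partition n : (0 < n)%N -> lambda01 (B n) = ((expR 1 * n`!%:R)^-1)%:E.
Proof.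
case: hB => H _ HB n0; rewrite -HB// /lambda01 /mrestr setIidl//.
by case: (H n n0).
Qed.

Lemma partition_unique (m n : nat) t : (0 < m)%N -> (0 < n)%N -> B m t -> B n t -> m = n.
Proof.
case: hB => _ tB _ m0 n0 Bm Bn.
by apply: tB => //; exists t.
Qed.

(** The partial sums are eventually constant, as at most one set of the
    partition contains w 0. *)
Lemma kruglov_cvg (f : R -> R) (w : Omega R) : (fun N => \sum_(1 <= n < N)
    \sum_(1 <= k < n.+1) f (w k) * \1_(B n) (w 0)) @ \oo --> kruglov B f w.
Proof.
rewrite /kruglov; set u := fun N => _; apply/cvg_ex.
have [[m m0 Bm]|nB] := pselect (exists2 m, (0 < m)%N & B m (w 0)).
  exists (u m.+1); apply: cvg_near_cst; exists m.+1 => // N /= mN.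
  rewrite /u (@big_cat_nat _ _ _ m.+1)//= [X in _ + X]big1_seq ?addr0//.
  move=> n /andP[_]; rewrite mem_index_iota => /andP[mn _].
  apply: big1 => k _; rewrite indicE memNset ?mulr0// => Bn.
  have n0 : (0 < n)%N by exact: leq_ltn_trans mn.
  by have := partition_unique m0 n0 Bm Bn => E; rewrite E ltnn in mn.
exists 0; apply: cvg_near_cst; apply: nearW => N; rewrite /u big1_seq// => n.
rewrite mem_index_iota => /andP[_ /andP[n0 _]].
apply: big1 => k _; rewrite indicE memNset ?mulr0// => Bn.
by apply: nB; exists n.
Qed.

Lemma kruglov_on (f : R -> R) (w : Omega R) m : (0 < m)%N -> B m (w 0) ->
  kruglov B f w = \sum_(1 <= k < m.+1) f (w k).
Proof.
move=> m0 Bm; rewrite -(cvg_lim (@Rhausdorff R) (@kruglov_cvg f w)).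
apply: cvg_lim => //; apply: cvg_near_cst; exists m.+1 => // N /= mN.
rewrite (@big_cat_nat _ _ _ m)//=; last by rewrite (leq_trans _ mN).
rewrite big1_seq ?add0r.
  rewrite big_ltn//= [X in _ + X]big1_seq ?addr0.
    by apply: eq_bigr => k _; rewrite indicE mem_set// mulr1.
  move=> n /andP[_]; rewrite mem_index_iota => /andP[mn _].
  apply: big1 => k _; rewrite indicE memNset ?mulr0// => Bn.
  have n0 : (0 < n)%N by exact: leq_ltn_trans mn.
  by have := partition_unique m0 n0 Bm Bn => E; rewrite E ltnn in mn.
move=> n /andP[_]; rewrite mem_index_iota => /andP[n0 mn].
apply: big1 => k _; rewrite indicE memNset ?mulr0// => Bn.
by have := partition_unique m0 n0 Bm Bn => E; rewrite E ltnn in mn.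
Qed.

Lemma kruglov_off (f : R -> R) (w : Omega R) :
  (forall m, (0 < m)%N -> ~ B m (w 0)) -> kruglov B f w = 0.
Proof.
move=> nB; rewrite -(cvg_lim (@Rhausdorff R) (@kruglov_cvg f w)).
apply: cvg_lim => //; apply: cvg_near_cst; apply: nearW => N.
rewrite big1_seq// => n; rewrite mem_index_iota => /andP[_ /andP[n0 _]].
by apply: big1 => k _; rewrite indicE memNset ?mulr0//; exact: nB.
Qed.

Lemma kruglovZ (c : R) (f : R -> R) w : kruglov B (c \*o f) w = c * kruglov B f w.
Proof.
have [[m m0 Bm]|nB] := pselect (exists2 m, (0 < m)%N & B m (w 0)).
  by rewrite !(kruglov_on _ m0 Bm) mulr_sumr.
have nB' m : (0 < m)%N -> ~ B m (w 0) by move=> m0 Bm; apply: nB; exists m.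
by rewrite !kruglov_off// mulr0.
Qed.

Lemma measurable_kruglov (f : R -> R) : measurable_fun setT f ->
  measurable_fun setT (kruglov B f).
Proof.
move=> mf; apply: (measurable_fun_cvg _ (fun w _ => @kruglov_cvg f w)) => N.
rewrite [X in measurable_fun _ X](_ : _ = fun w => \sum_(n <- index_iota 1 N)
   (if (0 < n)%N then \sum_(1 <= k < n.+1) f (w k) * \1_(B n) (w 0) else 0)); last first.
  apply/funext => w; rewrite !big_seq; apply: eq_bigr => n.
  by rewrite mem_index_iota => /andP[-> _].
apply: measurable_sum => n; have [n0|n0] := ltnP 0 n; last exact: measurable_cst.
apply: measurable_sum => k; apply: measurable_funM.
  exact: (measurableT_comp mf (measurable_coord k)).
have mi : measurable_fun setT (\1_(B n) : R -> R).
  by apply: measurable_indic; exact: measurable_partition.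
exact: (measurableT_comp mi (measurable_coord 0)).
Qed.

(** On the event that w 0 lies in B j, the image of 1 equals j. *)
Lemma kruglov_one_tail (j : nat) (s : R) : (0 < j)%N -> s < j%:R ->
  (((expR 1 * j`!%:R)^-1)%:E <= dfun P (kruglov B (cst (1%R : R))) s)%E.
Proof.
move=> j0 sj; rewrite -lambda01_partition// -(coord_law hP 0)//; last first.
  exact: measurable_partition.
apply: le_measure; rewrite ?inE.
- rewrite -[X in measurable X]setTI; apply: measurable_coord => //.
  exact: measurable_partition.
- by apply: measurable_superlevel; apply: measurable_kruglov; exact: measurable_cst.
- move=> w /= Bw; rewrite (kruglov_on _ j0 Bw)/= sumr_const_nat subSS subn0.
  by rewrite ger0_norm// mulrn_wge0.
Qed.

Section tail.
Variable h : R -> R.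
Hypotheses (mh : measurable_fun setT h) (h0 : forall t, 0 <= h t).

(** Convolution with the law of h, as a jump operator whose level -1 lets all
    values through. *)
Definition conv_op : (R -> \bar R) -> R -> \bar R :=
  jump_op lambda01 (fun=> h) (-1) 0.

Lemma conv_opE G x : conv_op G x = (\int[lambda01]_t G (x + h t)%R)%E.
Proof.
apply: eq_integral => t _; rewrite /jump_kernel/= ger0_norm//.
by rewrite (lt_le_trans _ (h0 t))// ltrN10.
Qed.

Lemma positive_conv_op : positive_operator conv_op.
Proof. by apply: positive_jump_op. Qed.

(** One step of the walk with increments h (w k) that starts at 0 if w 0 lies
    in A and is killed otherwise. The cemetery -1 is never reached by a
    surviving walk because h >= 0. *)
Definition killed_step (A : set R) (k : nat) (p : R * R) : R :=
  if k is 0 then \1_A p.2 - 1 else if p.1 < 0 then -1 else p.1 + h p.2.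

Definition alive (G : R -> \bar R) (z : R) : \bar R := if z < 0 then 0%E else G z.

Lemma nnborel_alive G : nnborel G -> nnborel (alive G).
Proof.
move=> [mG G0]; split; last by move=> z; rewrite /alive; case: ifP.
apply: measurable_fun_ifT => //; first by apply: measurable_fun_ltr.
Qed.

Lemma measurable_killed_step A k : measurable A -> measurable_fun setT (killed_step A k).
Proof.
move=> mA; case: k => [|k] /=.
  apply: measurable_funB; last exact: measurable_cst.
  by apply: (measurableT_comp _ measurable_snd); exact: measurable_indic.
apply: measurable_fun_ifT; [|exact: measurable_cst|].
  by apply: measurable_fun_ltr; [exact: measurable_fst|exact: measurable_cst].
by apply: measurable_funD; [exact: measurable_fst|exact: (measurableT_comp mh measurable_snd)].
Qed.

Let walk A k w := chain coord (killed_step A) 0 k.+1 w.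

(** Integrating out the last coordinate applies conv_op once. *)
Lemma killed_walk_integral A k G : measurable A -> nnborel G ->
  (\int[P]_w alive G (walk A k w) = lambda01 A * iter k conv_op G 0%R)%E.
Proof.
move=> mA; elim: k G => [|k IH] G nG.
  have [mG G0] := nG.
  transitivity (\int[P]_w (fun t => G 0%R * (\1_A t)%:E) (coord 0 w))%E.
    apply: eq_integral => w _; rewrite /alive /walk /= indicE.
    by case: (_ \in _); rewrite ?subrr ?ltxx ?mule1// sub0r ltrN10 mule0.
  rewrite (coord_integral hP 0 (F := fun t => (G 0%R * (\1_A t)%:E)%E))//; last 2 first.
  - by apply: measurable_funeM; apply/measurable_EFinP; exact: measurable_indic.
  - by move=> t; apply: mule_ge0; rewrite // lee_fin indicE.
  rewrite ge0_integralZl//; last by apply/measurable_EFinP; exact: measurable_indic.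
  by rewrite integral_indic// muleC; congr (_ * _)%E; congr (lambda01 _); rewrite setIT.
have [mG G0] := nG.
have [ma a0] := nnborel_alive nG.
have mst k' := measurable_killed_step k' mA.
pose H (p : R * R) := alive G (killed_step A k.+1 p).
have mH : measurable_fun setT H by exact: (measurableT_comp ma (mst k.+1)).
have H0 p : (0 <= H p)%E by exact: a0.
transitivity (\int[P]_w H (walk A k w, coord k.+1 w))%E; first by [].
rewrite (chain_integral (@measurable_coord R) (indep_coord hP) 0 mst _ mH H0).
have nC := po_nnborel positive_conv_op nG.
rewrite iterSr -IH//; apply: eq_integral => w _; rewrite -/(walk A k w).
set z := walk A k w.
rewrite (coord_integral hP k.+1 (F := fun t => H (z, t)) _ (fun t => H0 _)); last first.
  by apply: (measurableT_comp mH); apply: measurable_fun_pair => //; exact: measurable_cst.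
rewrite /H /killed_step/= {2}/alive; case: ifPn => z0.
  by under eq_integral do rewrite /alive ltrN10; rewrite integral0.
rewrite conv_opE; apply: eq_integral => t _; rewrite /alive ifF//.
by apply/negbTE; rewrite -leNgt addr_ge0// leNgt.
Qed.

Lemma walkE A k w : walk A k w =
  if w 0 \in A then \sum_(1 <= j < k.+1) h (w j) else -1.
Proof.
elim: k => [|k IH].
  by rewrite /walk/= indicE; case: ifP; rewrite ?subrr ?big_geq// sub0r.
transitivity (killed_step A k.+1 (walk A k w, w k.+1)); first by [].
rewrite /killed_step/= IH; case: (w 0 \in A); last by rewrite ltrN10.
rewrite ltNge sumr_ge0//= [in RHS]big_nat_recr//=.
Qed.

(** The set B m has measure 1 / (e m!), which is the m-th coefficient of the
    exponential series up to e, and on the corresponding event K h is a sum of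
    m independent copies of h. *)
Lemma kruglov_tail n (s : R) : 0 <= s ->
  (exp_trunc n conv_op (fun x => (\1_(`]s, +oo[%classic) x)%:E) 0%R <=
   (expR 1)%:E * dfun P (kruglov B h) s)%E.
Proof.
move=> s0; set G := fun x => _.
have nG : nnborel G.
  split; last by move=> x; rewrite lee_fin indicE.
  by apply/measurable_EFinP; apply: measurable_indic; exact: measurable_itv.
pose E m : set (Omega R) := [set w | s < walk (B m) m w].
have EB m w : (0 < m)%N -> E m w -> B m (w 0) /\ s < \sum_(1 <= j < m.+1) h (w j).
  rewrite /E /= walkE => m0; case: ifPn => [/[!inE]//|_].
  by move=> sN; have := lt_trans (le_lt_trans s0 sN) (@ltrN10 R); rewrite ltxx.
have mw m : (0 < m)%N -> measurable_fun setT (walk (B m) m).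
  move=> m0; exact: (measurable_chain (@measurable_coord R) 0
    (fun k => measurable_killed_step k (measurable_partition m0)) m.+1).
have mE m : (0 < m)%N -> measurable (E m).
  move=> m0; rewrite -[E m]setTI; apply: measurable_fun_ltr => //; first exact: mw.
have PE m : (0 < m)%N -> (P (E m) = lambda01 (B m) * iter m conv_op G 0%R)%E.
  move=> m0; rewrite -(killed_walk_integral m (measurable_partition m0) nG).
  rewrite -[X in P X]setIT -integral_indic//; last exact: mE.
  apply: eq_integral => w _; rewrite /alive /G !indicE.
  case: ltP => z0.
    rewrite memNset//= => sz.
    by have := lt_trans (le_lt_trans s0 sz) z0; rewrite ltxx.
  congr (_%:R%:E); congr nat_of_bool.
  by apply/idP/idP; rewrite !inE/= in_itv/= andbT.
rewrite /exp_trunc big_ord_recl /= /G indicE memNset ?mule0 ?add0e; last first.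
  by rewrite /= in_itv/= ltNge s0.
apply: (@le_trans _ _ (\sum_(m < n) ((expR 1)%:E * P (E m.+1)))%E).
  apply: lee_sum => m _; rewrite PE// lambda01_partition// muleA -EFinM invfM mulrA divff ?mul1r//.
rewrite -ge0_sume_distrr//; apply: lee_wpmul2l; first by rewrite lee_fin expR_ge0.
rewrite -measure_bigsetU_ord//; last 2 first.
- by move=> m; exact: mE.
- apply/trivIsetP => /= i j _ _ ij; apply/seteqP; split => // w [/= Ei Ej].
  have [Bi _] := EB i.+1 w isT Ei; have [Bj _] := EB j.+1 w isT Ej.
  have [] := partition_unique (ltn0Sn i) (ltn0Sn j) Bi Bj.
  by move=> /val_inj E'; rewrite E' eqxx in ij.
apply: le_measure; rewrite ?inE.
- by apply: bigsetU_measurable => m _; exact: mE.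
- by apply: measurable_superlevel; exact: measurable_kruglov.
- rewrite -(bigcup_mkord n (fun m => E m.+1)) => w [m /= _ Em]; have [Bm sm] := EB m.+1 w isT Em.
  by rewrite /= (kruglov_on _ (ltn0Sn m) Bm) (lt_le_trans sm)// ler_norm.
Qed.

End tail.
End kruglov_operator.

(** * Disjointification *)

Section translation.
Context (R : realType).

Lemma lebesgue_measure_translate (c : R) (A : set R) : measurable A ->
  lebesgue_measure [set t | A (t - c)] = lebesgue_measure A.
Proof.
move=> mA.
have mt : measurable_fun setT ((fun t => t - c) : measurableTypeR R -> measurableTypeR R).
  have : measurable_fun setT (fun t : R => t - c).
    by apply: measurable_funB => //; exact: measurable_cst.
  by [].
pose p := measure_function_pushforward__canonical__measure_function_Measure
  (@lebesgue_measure R) mt.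
suff : lebesgue_measure A = p A by move=> ->.
apply: lebesgue_measure_unique => // _ [[a b]] _ <-.
rewrite /= /pushforward.
rewrite (_ : _ @^-1` _ = [set` `](a + c), (b + c)]]); last first.
  by apply/seteqP; split => t /=; rewrite !in_itv/= ltrBrDr lerBlDr.
rewrite !lebesgue_measure_itv/= !lte_fin ltrD2r; case: ifP => // _.
by rewrite -!EFinB; congr (_%:E); ring.
Qed.

End translation.

Section disjointification.
Context (R : realType) (g : nat -> R -> R) (n : nat).
Hypothesis mg : forall k, measurable_fun setT (g k).

Let F := @disjointification R n (fun i => g i).

Lemma measurable_disjointification : measurable_fun setT F.
Proof.
apply: measurable_sum => k; apply: measurable_funM.
  apply: (measurableT_comp (mg k)); exact: measurable_funB.
by apply: measurable_indic; exact: measurable_itv.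
Qed.

Let piece (k : nat) : set R := `]k%:R, (k%:R + 1)[%classic.

Lemma disjointification_piece (k : nat) t : (k < n)%N -> piece k t -> F t = g k (t - k%:R).
Proof.
rewrite /piece/= in_itv/= => kn /andP[kt tk].
rewrite /F /disjointification (bigD1 (Ordinal kn))//= indicE mem_set; last first.
  by rewrite /= in_itv/= !ltW.
rewrite mulr1 big1 ?addr0// => j jk; rewrite indicE memNset ?mulr0//=.
rewrite in_itv/= => /andP[jt tj]; move/eqP: jk; apply; apply: val_inj => /=.
have H1 : (j < k.+1)%N by rewrite -(ltr_nat R) -natr1; exact: le_lt_trans tk.
have H2 : (k < j.+1)%N by rewrite -(ltr_nat R) -natr1; exact: lt_le_trans tj.
by apply/eqP; rewrite eqn_leq -ltnS H1 -ltnS H2.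
Qed.

(** Up to the integer points, F is a translate of g k on the k-th piece. *)
Lemma dfun_disjointification s : 0 <= s ->
  dfun lebesgue_measure F s = (\sum_(k < n) dfun lambda01 (g k) s)%E.
Proof.
move=> s0; set E := [set x | s < `|F x|].
have mE : measurable E by apply: measurable_superlevel; exact: measurable_disjointification.
have mp k : measurable (piece k) by exact: measurable_itv.
pose Z : set R := \bigcup_(k in [set k | (k < n.+1)%N]) [set k%:R].
have Zk (k : nat) : (k < n.+1)%N -> Z k%:R by move=> kn; exists k.
have mZ : measurable Z by apply: bigcup_measurable => k _; exact: measurable_set1.
have Z0 : lebesgue_measure Z = 0%E.
  apply: countable_lebesgue_measure0; apply: bigcup_countable => //.
pose EP (k : 'I_n) : set R := E `&` piece k.
have mEP k : measurable (EP k) by exact: measurableI.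
have UE : \big[setU/set0]_(k < n) EP k `<=` E.
  elim/big_ind: _ => //; first by move=> A A' AE AE' u [/AE|/AE'].
  by move=> k _ u [].
have EE : E = (\big[setU/set0]_(k < n) EP k) `|` (E `&` Z).
  apply/seteqP; split => t; last first.
    by case=> [|[]//]; exact: UE.
  move=> Et; have [k kt] : exists k : 'I_n, t \in `[k%:R, (k%:R + 1)].
    apply: contrapT => /forallNP nk; move: Et; rewrite /E/=.
    rewrite (_ : F t = 0) ?normr0 ?ltNge ?s0//.
    rewrite /F /disjointification big1// => k _; rewrite indicE memNset ?mulr0//.
    exact: nk.
  move: kt; rewrite in_itv/= => /andP[kt tk].
  have [tE|tk0] := eqVneq k%:R t; first by right; split => //; rewrite -tE; apply: Zk; rewrite ltnS ltnW.
  have [tk1|tk1] := eqVneq t (k%:R + 1); first by right; split => //; rewrite tk1 natr1; apply: Zk; rewrite ltnS.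
  left; rewrite (bigD1 k)//=; left; split => //; rewrite /piece/= in_itv/=.
  by rewrite !lt_neqAle tk0 tk1 kt tk.
rewrite /dfun -/E [in LHS]EE.
rewrite [LHS](@measureU0 _ _ _ lebesgue_measure); last 3 first.
- by apply: bigsetU_measurable => k _; exact: mEP.
- exact: measurableI.
- apply: (@subset_measure0 _ _ _ lebesgue_measure _ _ _ _ (@subIsetr _ _ _) Z0) => //.
  exact: measurableI.
rewrite measure_bigsetU_ord//; last first.
  apply/trivIsetP => /= i j _ _ ij; apply/seteqP; split => // t [[_ ti] [_ tj]].
  move/eqP: ij; apply; apply: val_inj => /=.
  move: ti tj; rewrite /piece/= !in_itv/= => /andP[it ti] /andP[jt tj].
  have H1 : (j < i.+1)%N by rewrite -(ltr_nat R) -natr1; exact: lt_trans ti.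
  have H2 : (i < j.+1)%N by rewrite -(ltr_nat R) -natr1; exact: lt_trans tj.
  by apply/eqP; rewrite eqn_leq -ltnS H2 -ltnS H1.
apply: eq_bigr => k _.
have mk := measurable_superlevel s (mg k).
transitivity (lambda01 [set x | s < `|g k x|]); last by [].
rewrite lambda01_interior//.
have m01 : measurable (`]0, 1[%classic : set R) by exact: measurable_itv.
rewrite -(lebesgue_measure_translate k%:R); last exact: measurableI.
congr (lebesgue_measure _); rewrite /EP /E /piece; apply/seteqP; split => t /=.
  move=> [Et kt]; move: (kt); rewrite !in_itv/= subr_gt0 ltrBlDl => ->; split => //.
  by rewrite -disjointification_piece.
rewrite !in_itv/= subr_gt0 ltrBlDl => -[gt kt]; split => //.
have pk : piece k t by rewrite /piece/= in_itv.
by rewrite (disjointification_piece (ltn_ord k) pk).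
Qed.

Lemma dfun_disjointification_lty : (dfun lebesgue_measure F 0 < +oo)%E.
Proof.
rewrite dfun_disjointification//; elim/big_ind: _ => //.
- by move=> x y; exact: lte_add_pinfty.
- by move=> k _; exact: dfun01_fin.
Qed.

Let h := @rearr_head R n (fun i => g i).

Lemma measurable_rearr_head : measurable_fun setT h.
Proof.
apply: measurable_funM; last by apply: measurable_indic; exact: measurable_itv.
exact: (measurable_rearr (mu := lebesgue_measure) measurable_disjointification dfun_disjointification_lty).
Qed.

Lemma rearr_head_ge0 t : 0 <= h t.
Proof. by rewrite /h /rearr_head mulr_ge0// ?rearr_ge0// indicE. Qed.

Lemma rearr_headE t : 0 < t -> t <= 1 -> h t = rearr lebesgue_measure F t.
Proof.
move=> t0 t1; rewrite /h /rearr_head indicE mem_set ?mulr1//= in_itv/= t1 andbT.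
exact: ltW.
Qed.

Lemma dfun_rearr_head s : 0 <= s ->
  dfun lambda01 h s = mine (\sum_(k < n) dfun lambda01 (g k) s)%E 1%E.
Proof.
move=> s0; rewrite -dfun_disjointification//.
apply: (dfun_rearr (mu := lebesgue_measure) measurable_disjointification dfun_disjointification_lty) => //.
  exact: measurable_rearr_head.
by move=> t /andP[t0 t1]; rewrite rearr_headE// ltW.
Qed.

(** The values above this level have total measure at most 1. *)
Definition level : R := rearr lebesgue_measure F 1.

Lemma level_ge0 : 0 <= level.
Proof. exact: rearr_ge0. Qed.

Lemma level_tail c : level <= c -> (\sum_(k < n) dfun lambda01 (g k) c <= 1)%E.
Proof.
move=> lc; have c0 := le_trans level_ge0 lc.
rewrite -dfun_disjointification// leNgt; apply/negP => H.
have : c < level.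
  exact/(lt_rearr (mu := lebesgue_measure) measurable_disjointification dfun_disjointification_lty c0 ltr01).
by rewrite ltNge lc.
Qed.

Lemma level_le_head t : 0 < t -> t <= 1 -> level <= h t.
Proof.
move=> t0 t1; rewrite rearr_headE//.
exact: (rearr_nonincreasing (mu := lebesgue_measure) measurable_disjointification
  dfun_disjointification_lty t0 t1).
Qed.

(** Above the truncation level, the law of h is the sum of the laws of the |g
    k|, because there the cap at 1 is inactive. *)
Lemma total_jump_le_conv G x : nnborel G ->
  (total_jump_op lambda01 g level n G x <= conv_op h G x)%E.
Proof.
move=> [mG G0]; rewrite total_jump_opE conv_opE; last exact: rearr_head_ge0.
pose G' y := G (x + y).
have mG' : measurable_fun setT G'.
  by apply: (measurableT_comp mG); apply: measurable_funD => //; exact: measurable_cst.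
have mh := measurable_rearr_head.
have mn k : measurable_fun setT (fun t => `|g k t|) by exact: measurableT_comp.
pose D k := [set t | level < `|g k t|].
have mD k : measurable (D k) by exact: measurable_superlevel.
pose Dh := [set t | level < h t].
have mDh : measurable Dh.
  by rewrite -[Dh]setTI; apply: measurable_fun_ltr => //; exact: measurable_cst.
have mn' k : measurable_fun setT ((fun t => `|g k t|) : measurableTypeR R -> measurableTypeR R).
  exact: mn.
have mh' : measurable_fun setT (h : measurableTypeR R -> measurableTypeR R) by exact: mh.
pose r k : {measure set (measurableTypeR R) -> \bar R} := mrestr lambda01 (mD k).
pose p k := measure_function_pushforward__canonical__measure_function_Measure (r k) (mn' k).
pose rh : {measure set (measurableTypeR R) -> \bar R} := mrestr lambda01 mDh.
pose ph := measure_function_pushforward__canonical__measure_function_Measure rh mh'.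
have rays (f : R -> R) c : f @^-1` `]c, +oo[%classic = [set t | c < f t].
  by apply/seteqP; split => t /=; rewrite in_itv/= andbT.
have law (A : set R) : measurable A -> msum p n A = ph A.
  apply: eq_measure_rays.
    change (\sum_(k < n) p k setT < +oo)%E; elim/big_ind: _ => //.
    - by move=> u v; exact: lte_add_pinfty.
    - move=> k _; rewrite /= /pushforward /mrestr preimage_setT setTI.
      exact: (le_lt_trans (probability_le1 lambda01 (mD k)) (ltry _)).
  move=> c; rewrite /msum /= /pushforward /mrestr.
  have lm : level <= Num.max c level by rewrite le_max lexx orbT.
  have m0 : 0 <= Num.max c level by rewrite (le_trans level_ge0).
  transitivity (\sum_(k < n) dfun lambda01 (g k) (Num.max c level))%E.
    change (\sum_(k < n) p k `]c, +oo[%classic =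
      \sum_(k < n) dfun lambda01 (g k) (Num.max c level))%E.
    apply: eq_bigr => k _.
    transitivity (lambda01 ((fun t => `|g k t|) @^-1` `]c, +oo[%classic `&` D k)) => //.
    rewrite rays /dfun; congr (lambda01 _).
    by apply/seteqP; split => t /=; rewrite gt_max => /andP.
  rewrite rays -(min_idPl (level_tail lm)) -dfun_rearr_head// /dfun.
  congr (lambda01 _); apply/seteqP; split => t /=; rewrite gt_max ger0_norm ?rearr_head_ge0//.
    by move=> /andP[].
  by move=> [ch lh]; apply/andP.
apply: (@le_trans _ _ (\int[msum p n]_y G' y)%E).
  rewrite ge0_integral_measure_sum//; last by move=> y _; exact: G0.
  apply: lee_sum => k _; rewrite le_eqVlt; apply/orP; left; apply/eqP.
  apply/esym; apply: (etrans (ge0_integral_pushforward (mn' k) (r k) measurableT _ _)) => //.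
    by move=> y _; exact: G0.
  rewrite preimage_setT (@ge0_integral_mrestr _ _ _ lambda01)//; last 2 first.
  - exact: (measurableT_comp mG' (mn k)).
  - by move=> t; exact: G0.
  rewrite integral_mkcond; apply: eq_integral => t _.
  rewrite patchE /jump_kernel/=.
  by have -> : (t \in D k) = (level < `|g k t|) by apply/idP/idP; rewrite inE.
apply: (@le_trans _ _ (\int[ph]_y G' y)%E).
  rewrite le_eqVlt; apply/orP; left; apply/eqP.
  by apply: eq_measure_integral => A mA _; exact: law.
apply: (@le_trans _ _ (\int[rh]_t G' (h t))%E).
  rewrite le_eqVlt; apply/orP; left; apply/eqP.
  apply: (etrans (ge0_integral_pushforward mh' rh measurableT _ _)) => //.
  by move=> y _; exact: G0.
have mGh : measurable_fun setT (fun t => G' (h t)) by exact: (measurableT_comp mG' mh).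
rewrite (@ge0_integral_mrestr _ _ _ lambda01)//; last by move=> t; exact: G0.
by apply: ge0_subset_integral => // t _; exact: G0.
Qed.

End disjointification.

(** * Maximal partial sums *)

Section maximal_function.
Context (R : realType).
Implicit Types (g : nat -> R -> R) (n : nat).

Definition maxpsum g n (t : R) : R := \big[Num.max/0]_(k < n) `|psum g k.+1 t|.

Lemma max_partial_sumE g n : @max_partial_sum R n (fun i => g i) = maxpsum g n.
Proof.
apply/funext => t; apply: eq_bigr => k _; congr (`| _ |).
rewrite /partial_sum /psum (big_ord_widen n (fun i => g i t))//.
Qed.

Lemma maxpsum_ge0 g n t : 0 <= maxpsum g n t.
Proof. exact: bigmax_ge_id. Qed.

Lemma psum_le_maxpsum g n k t : (k <= n)%N -> `|psum g k t| <= maxpsum g n t.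
Proof.
case: k => [|k] kn; first by rewrite /psum big_ord0 normr0 maxpsum_ge0.
exact: (le_bigmax _ (fun i : 'I_n => `|psum g i.+1 t|) (Ordinal kn)).
Qed.

Lemma maxpsum_le g n t c : 0 <= c -> (forall k, (k <= n)%N -> `|psum g k t| <= c) ->
  maxpsum g n t <= c.
Proof. by move=> c0 H; apply: bigmax_le => // k _; exact: H. Qed.

Lemma measurable_bigmax (I : Type) (r : seq I) (F : I -> R -> R) :
  (forall i, measurable_fun setT (F i)) ->
  measurable_fun setT (fun t => \big[Num.max/0]_(i <- r) F i t).
Proof.
move=> mF; elim: r => [|i r IH].
  by under eq_fun do rewrite big_nil; exact: measurable_cst.
by under eq_fun do rewrite big_cons; exact: measurable_maxr.
Qed.

Lemma measurable_maxpsum g n : (forall k, measurable_fun setT (g k)) ->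
  measurable_fun setT (maxpsum g n).
Proof.
move=> mg; apply: measurable_bigmax => k; apply: measurableT_comp => //.
exact: measurable_psum.
Qed.

(** Since min(S, 1) <= 2 S / (1 + S), this shows that a union of independent
    events has at least half the probability min(S, 1). *)
Lemma prod_compl_le n (p : nat -> R) : (forall k, 0 <= p k <= 1) ->
  (\prod_(k < n) (1 - p k)) * (1 + \sum_(k < n) p k) <= 1.
Proof.
move=> p01; elim: n => [|n IH]; first by rewrite !big_ord0 addr0 mulr1.
rewrite !big_ord_recr/=; set a := \prod_(_ < _) _; set S := \sum_(_ < _) _.
have a0 : 0 <= a by apply: prodr_ge0 => k _; have := p01 k; lra.
have S0 : 0 <= S by apply: sumr_ge0 => k _; have := p01 k; lra.
apply: le_trans IH; rewrite -mulrA ler_wpM2l//.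
rewrite -/S; have /andP[q0 q1] := p01 n.
have Sp := mulr_ge0 S0 q0; have pp := mulr_ge0 q0 q0.
have -> : (1 - p n) * (1 + (S + p n)) = 1 + S - S * p n - p n * p n by ring.
by lra.
Qed.

Lemma indep_seq_comp d (T : measurableType d) (Q : probability T R)
    (u : nat -> T -> R) (phi : nat -> R -> R) :
  indep_seq Q u -> (forall k, measurable_fun setT (phi k)) ->
  indep_seq Q (fun k w => phi k (u k w)).
Proof.
move=> iu mphi n A mA; have := iu n (fun k => phi k @^-1` A k); apply => k.
by rewrite -[X in measurable X]setTI; exact: mphi.
Qed.

End maximal_function.

(** * The lower estimate *)

Section lower_estimate.
Context (R : realType) (X : fspace R) (g : nat -> R -> R) (n : nat).
Hypothesis sX : symmetric_space X.
Let bX := ss_banach sX.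
Hypothesis Xg : forall k, X (g k).
Hypothesis ig : indep_seq lambda01 g.

Let mg k : measurable_fun setT (g k). Proof. exact: (bfs_measurable bX (Xg k)). Qed.

Let U := maxpsum g n.
Let mU : measurable_fun setT U. Proof. exact: (measurable_maxpsum n mg). Qed.
Let h := @rearr_head R n (fun i => g i).

Lemma ss_norm (f : R -> R) : X f -> X (fun t => `|f t|).
Proof.
move=> Xf; have mf := bfs_measurable bX Xf.
have mn : measurable_fun setT (fun t => `|f t|) by exact: measurableT_comp.
have H (t : R) : `| (`|f t|) | <= `|f t| by rewrite normr_id.
by have [] := ss_le sX Xf mn H.
Qed.

Lemma ss_maxpsum : X U.
Proof.
have [Xs _] := ss_sum sX (index_enum 'I_n) (fun i : 'I_n => ss_norm (Xg i)).
suff H t : `|U t| <= `|\sum_(i < n) `|g i t| | by have [] := ss_le sX Xs mU H.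
rewrite ger0_norm ?maxpsum_ge0// (le_trans _ (ler_norm _))//.
apply: maxpsum_le => [|k kn]; first exact: sumr_ge0.
apply: (le_trans (ler_norm_sum _ _ _)).
rewrite (big_ord_widen n (fun i => `|g i t|))// [leLHS]big_mkcond/=.
by apply: ler_sum => i _; case: ifP.
Qed.

Definition maxabs t : R := \big[Num.max/0]_(k < n) `|g k t|.

Lemma measurable_maxabs : measurable_fun setT maxabs.
Proof. by apply: measurable_bigmax => k; apply: measurableT_comp => //; exact: mg. Qed.

Lemma dfun_maxabs s : 0 <= s ->
  dfun lambda01 maxabs s = (1 - \prod_(k < n) (1 - fine (dfun lambda01 (g k) s)))%:E.
Proof.
move=> s0; pose A : set R := [set y | `|y| <= s].
have mA : measurable A.
  have mn : measurable_fun setT (fun y : R => `|id y|) by apply: measurableT_comp.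
  rewrite -[A]setTI; apply: measurable_fun_ler => //; exact: measurable_cst.
have mM := measurable_superlevel s measurable_maxabs.
have C (f : R -> R) : measurable_fun setT f ->
   lambda01 [set t | `|f t| <= s] = (1 - fine (dfun lambda01 f s))%:E.
  move=> mf; have ms := measurable_superlevel s mf.
  have -> : [set t | `|f t| <= s] = ~` [set t | s < `|f t|].
    by apply/seteqP; split => t /=; rewrite leNgt => /negP.
  rewrite [LHS](@probability_setC _ _ _ lambda01)// EFinB fineK//.
  by rewrite ge0_fin_numE ?dfun01_fin// measure_ge0.
have := ig n (fun=> mA).
have -> : [set w | forall k, (k < n)%N -> A (g k w)] = [set t | `|maxabs t| <= s].
  have M0 t : 0 <= maxabs t by exact: bigmax_ge_id.
  apply/seteqP; split => t /= H.
    by rewrite ger0_norm//; apply: bigmax_le => // k _; exact: H.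
  move=> k kn; rewrite /A/=; apply: le_trans H; rewrite (ger0_norm (M0 t)).
  exact: (le_bigmax _ (fun i : 'I_n => `|g i t|) (Ordinal kn)).
move/(etrans (esym (C _ measurable_maxabs))).
have -> : (\prod_(k < n) lambda01 (g k @^-1` A))%E =
    (\prod_(k < n) (1 - fine (dfun lambda01 (g k) s)))%:E.
  rewrite -prodEFin; apply: eq_bigr => k _; exact: C.
move=> [E]; rewrite -E; rewrite subKr fineK//.
by rewrite ge0_fin_numE ?dfun01_fin ?measure_ge0//; exact: measurable_maxabs.
Qed.

(** Each g k is a difference of two partial sums, so the maximum of the |g k|
    is at most 2 U. By independence h has at most twice its distribution
    function. *)
Lemma rearr_head_le : X h /\ fs_norm X h <= 4 * fs_norm X U.
Proof.
have mh : measurable_fun setT h by exact: (measurable_rearr_head n mg).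
have XU := ss_maxpsum.
have [XM nM] : X maxabs /\ fs_norm X maxabs <= fs_norm X (2 \*o U).
  apply: (ss_le sX); [exact: bfs_Z|exact: measurable_maxabs|].
  move=> t; rewrite ger0_norm; last exact: bigmax_ge_id.
  rewrite /= ger0_norm ?mulr_ge0 ?maxpsum_ge0//.
  apply: bigmax_le => [|k _]; first by rewrite mulr_ge0 ?maxpsum_ge0.
  have -> : g k t = psum g k.+1 t - psum g k t.
    by rewrite /psum big_ord_recr/= addrAC subrr add0r.
  rewrite (le_trans (ler_normB _ _))// mulr_natl mulr2n lerD// psum_le_maxpsum//.
  by rewrite ltnW.
have [Xh nh] : X h /\ fs_norm X h <= 2 * fs_norm X maxabs.
  apply: (ss_dilate2 sX XM mh) => s s0.
  rewrite dfun_rearr_head// dfun_maxabs//.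
  pose p k := fine (dfun lambda01 (g k) s).
  have fin k : dfun lambda01 (g k) s \is a fin_num.
    by rewrite ge0_fin_numE ?dfun01_fin// measure_ge0//; exact: measurable_superlevel.
  have p01 k : 0 <= p k <= 1.
    rewrite -!lee_fin fineK// dfun01_le1// andbT measure_ge0//.
  have -> : (\sum_(k < n) dfun lambda01 (g k) s)%E = (\sum_(k < n) p k)%:E.
    by rewrite -sumEFin; apply: eq_bigr => k _; rewrite fineK.
  have := prod_compl_le n p01.
  set a := \prod_(k < n) (1 - p k); set S := \sum_(k < n) p k => aS.
  have a0 : 0 <= a by apply: prodr_ge0 => k _; have := p01 k; lra.
  have S0 : 0 <= S by apply: sumr_ge0 => k _; have := p01 k; lra.
  rewrite -EFinM -EFin_min lee_fin ge_min.
  have [S1|S1] := leP S 1; apply/orP; [left|right]; nra.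
split => //; apply: (le_trans nh).
have := nM; rewrite (bfs_normZ bX)// normr_nat.
lra.
Qed.

Lemma L1_norm_le (f : R -> R) : X f -> measurable_fun setT f ->
  (\int[lambda01]_t (`|f t|)%:E = (fs_norm (Lp_fspace 1%E) f)%:E)%E /\
  fs_norm (Lp_fspace 1%E) f <= fs_norm X f.
Proof.
move=> Xf mf; have H := L1_le_ss sX Xf.
have E : (\int[lambda01]_t (`|f t|)%:E = (fs_norm (Lp_fspace 1%E) f)%:E)%E.
  rewrite /= Lnorm1 fineK//.
  rewrite ge0_fin_numE; last by apply: integral_ge0.
  by apply: (le_lt_trans H); rewrite ltry.
by split => //; rewrite -lee_fin -E.
Qed.

Lemma lower_estimate :
  5^-1 * (fs_norm X h + fs_norm (Lp_fspace 1%E) U) <= fs_norm X U.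
Proof.
have [Xh nh] := rearr_head_le.
have [_ n1] := L1_norm_le ss_maxpsum mU.
lra.
Qed.

End lower_estimate.

(** * The norm of the Kruglov operator *)

Section kruglov_norm.
Context (R : realType) (P : probability (Omega R) R) (B : nat -> set R) (X : fspace R).
Hypothesis hP : is_product_measure P.
Hypothesis hB : kruglov_partition B.
Hypothesis sX : symmetric_space X.
Hypothesis KX : kruglov_bounded P B X.
Let bX := ss_banach sX.

Lemma dfunP_fin f : measurable_fun setT f -> (dfun P (kruglov B f) 0 < +oo)%E.
Proof.
move=> mf; apply: (le_lt_trans _ (ltry 1)); apply: probability_le1.
by apply: measurable_superlevel; exact: measurable_kruglov.
Qed.

Lemma measurable_kruglov_rearr f : measurable_fun setT f ->
  measurable_fun setT (kruglov_rearr P B f).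
Proof.
move=> mf; exact: (measurable_rearr (mu := P) (measurable_kruglov hB mf) (dfunP_fin mf)).
Qed.

Lemma dfun_kruglov_rearr f s : measurable_fun setT f -> 0 <= s ->
  dfun lambda01 (kruglov_rearr P B f) s = dfun P (kruglov B f) s.
Proof.
move=> mf s0.
have := dfun_rearr (mu := P) (measurable_kruglov hB mf) (dfunP_fin mf)
   (measurable_kruglov_rearr mf) (fun t _ => erefl) s0.
move=> ->; apply/min_idPl; apply: probability_le1.
by apply: measurable_superlevel; exact: measurable_kruglov.
Qed.

Lemma dfunZ d (T : measurableType d) (mu : {measure set T -> \bar R}) (c : R) (u : T -> R) s :
  0 < c -> dfun mu (c \*o u) s = dfun mu u (s / c).
Proof.
move=> c0; congr (mu _); apply/seteqP; split => t /=;
  by rewrite normrM gtr0_norm// ltr_pdivrMr// mulrC.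
Qed.

(** Homogeneity reduces to the unit ball. Bounding the norm by some c > 0
    instead of dividing by it includes functions of norm 0. *)
Lemma kruglov_rearr_le f c : X f -> 0 < c -> fs_norm X f <= c ->
  X (kruglov_rearr P B f) /\
  fs_norm X (kruglov_rearr P B f) <= kruglov_opnorm P B X * c.
Proof.
move=> Xf c0 fc; have mf := bfs_measurable bX Xf.
have Xf1 : X (c^-1 \*o f) by exact: bfs_Z.
have mf1 := bfs_measurable bX Xf1.
have f1 : fs_norm X (c^-1 \*o f) <= 1.
  by rewrite (bfs_normZ bX)// gtr0_norm ?invr_gt0// mulrC ler_pdivrMr// mul1r.
have XK1 := KX.1 _ Xf1.
have K1 : fs_norm X (kruglov_rearr P B (c^-1 \*o f)) <= kruglov_opnorm P B X.
  by apply: (ub_le_sup KX.2); exists (c^-1 \*o f).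
have [XK K] : X (kruglov_rearr P B f) /\ fs_norm X (kruglov_rearr P B f) <=
    fs_norm X (c \*o kruglov_rearr P B (c^-1 \*o f)).
  apply: (ss_dom sX (bfs_Z bX _ XK1) (measurable_kruglov_rearr mf)) => s s0.
  rewrite (dfunZ _ _ _ c0) (dfun_kruglov_rearr mf s0).
  rewrite (dfun_kruglov_rearr mf1); last by rewrite divr_ge0// ltW.
  rewrite -(dfunZ P _ _ c0) (_ : c \*o kruglov B (c^-1 \*o f) = kruglov B f)//.
  apply/funext => w /=; rewrite -(kruglovZ hB); congr (kruglov B _ w).
  by apply/funext => t /=; rewrite mulrA divff ?gt_eqF// mul1r.
split => //; apply: (le_trans K).
by rewrite (bfs_normZ bX)// gtr0_norm// mulrC ler_wpM2r// ltW.
Qed.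

Lemma kruglov_one : X (kruglov_rearr P B (cst 1)) /\
  fs_norm X (kruglov_rearr P B (cst 1)) <= kruglov_opnorm P B X.
Proof.
have [X1 n1] := ss_cst sX.
by have := kruglov_rearr_le X1 ltr01; rewrite mulr1 n1; apply.
Qed.

(** The image of 1 is at least 1 on a set of measure at least 1/e >= 1/4.
    Constants can thus be absorbed into the operator norm. *)
Lemma kruglov_opnorm_ge : 1 <= 4 * kruglov_opnorm P B X.
Proof.
have [X1 n1] := ss_cst sX; have [Xk nk] := kruglov_one.
have mc : measurable_fun setT (cst 1 : R -> R) by exact: measurable_cst.
have [_ H] : X (cst 1) /\ fs_norm X (cst 1) <= 4 * fs_norm X (kruglov_rearr P B (cst 1)).
  apply: (ss_dilate4 sX Xk mc) => s s0; rewrite dfun_kruglov_rearr//.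
  have [s1|s1] := ltP s 1; last first.
    rewrite (_ : dfun lambda01 _ s = 0%E) ?mule_ge0//.
    rewrite /dfun (_ : [set x | _] = set0) ?measure0//.
    by apply/seteqP; split => // t /=; rewrite normr1 ltNge s1.
  apply: (le_trans (dfun01_le1 s mc)).
  have := @kruglov_one_tail R P B hP hB 1 s isT s1; rewrite mulr1 => H.
  apply: le_trans (lee_wpmul2l _ H); last by rewrite lee_fin.
  rewrite -EFinM lee_fin ler_pdivlMr ?expR_gt0// mul1r.
  exact: expR1_le4.
by rewrite n1 in H; lra.
Qed.

End kruglov_norm.

(** * The upper estimate *)

Section upper_estimate.
Context (R : realType) (P : probability (Omega R) R) (B : nat -> set R) (X : fspace R).
Context (g : nat -> R -> R) (n : nat).
Hypothesis hP : is_product_measure P.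
Hypothesis hB : kruglov_partition B.
Hypothesis sX : symmetric_space X.
Hypothesis KX : kruglov_bounded P B X.
Hypothesis Xg : forall k, X (g k).
Hypothesis ig : indep_seq lambda01 g.
Let bX := ss_banach sX.
Let mg k : measurable_fun setT (g k). Proof. exact: (bfs_measurable bX (Xg k)). Qed.

Let U := maxpsum g n.
Let mU : measurable_fun setT U. Proof. exact: (measurable_maxpsum n mg). Qed.
Let h := @rearr_head R n (fun i => g i).
Let mh : measurable_fun setT h. Proof. exact: (measurable_rearr_head n mg). Qed.
Let h0 t : 0 <= h t. Proof. exact: rearr_head_ge0. Qed.
Let Xh : X h. Proof. exact: (rearr_head_le n sX Xg ig).1. Qed.
Let K := kruglov_opnorm P B X.

Variable D : R.
Hypothesis D0 : 0 < D.
Hypothesis hD : fs_norm X h + fs_norm (Lp_fspace 1%E) U <= D.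

Let s0 := level g n.
Let s0_ge0 : 0 <= s0. Proof. exact: level_ge0. Qed.

Definition large_sum (t : R) : R := \sum_(i < n) large_part s0 (g i t).
Let A := large_sum.

Lemma large_part_ge0 (c y : R) : 0 <= large_part c y.
Proof. by rewrite /large_part; case: ifP. Qed.

Lemma large_sum_ge0 t : 0 <= A t.
Proof. by apply: sumr_ge0 => i _; exact: large_part_ge0. Qed.

Lemma measurable_large_sum : measurable_fun setT A.
Proof.
apply: measurable_sum => i; exact: (measurableT_comp (measurable_large_part _) (mg i)).
Qed.

(** The sum is compared with its Poissonization, whose tail is that of K h up
    to the factor e <= 4. *)
Lemma dfun_large_sum s : 0 <= s ->
  (dfun lambda01 A s <= 4%:E * dfun lambda01 (kruglov_rearr P B h) s)%E.
Proof.
move=> s_ge0; rewrite (dfun_kruglov_rearr P hB mh s_ge0).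
pose G (x : R) : \bar R := (\1_(`]s, +oo[%classic) x)%:E.
have nG : nnborel G.
  split; last by move=> x; rewrite lee_fin indicE.
  by apply/measurable_EFinP; apply: measurable_indic; exact: measurable_itv.
have mA := measurable_superlevel s measurable_large_sum.
have -> : dfun lambda01 A s =
    (\int[lambda01]_w G (0 + \sum_(i < n) large_part s0 (g i w))%R)%E.
  transitivity (\int[lambda01]_w (\1_[set t | s < `|A t|] w)%:E)%E.
    by rewrite integral_indic// setIT.
  apply: eq_integral => w _; rewrite /G !indicE add0r; congr ((_ : bool)%:R%:E).
  apply/idP/idP; rewrite !inE/= in_itv/= andbT ger0_norm//; exact: large_sum_ge0.
apply: (le_trans (@sum_large_le _ _ R (@lambda01 R) g s0 mg ig n G 0 nG)).
apply: (@le_trans _ _ (exp_trunc n (conv_op h) G 0)).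
  apply: lee_sum => m _; apply: lee_wpmul2l; first by rewrite lee_fin inv_fact_ge0.
  apply: iter_le => //; [exact: positive_total_jump_op|exact: positive_conv_op|].
  by move=> H nH x; exact: total_jump_le_conv.
apply: (le_trans (kruglov_tail hP hB mh h0 n s_ge0)).
by apply: lee_wpmul2r; rewrite ?lee_fin ?expR1_le4//; exact: measure_ge0.
Qed.

Let hleD : fs_norm X h <= D.
Proof.
apply: le_trans hD; rewrite lerDl.
by rewrite fine_ge0// Lnorm_ge0.
Qed.

Lemma ss_large_sum : X A /\ fs_norm X A <= 4 * (K * D).
Proof.
have [XK nK] := kruglov_rearr_le hB sX KX Xh D0 hleD.
have [XA nA] := ss_dilate4 sX XK measurable_large_sum dfun_large_sum.
by split => //; apply: (le_trans nA); rewrite ler_wpM2l.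
Qed.

(** On nonnegative numbers the mean is the jump operator applied to the
    identity, and the total jump operator is at most the convolution with the
    law of h. *)
Lemma large_sum_L1 : (\int[lambda01]_t (A t)%:E <= (fs_norm X h)%:E)%E.
Proof.
pose G (y : R) : \bar R := (Num.max y 0)%:E.
have nG : nnborel G.
  split; last by move=> y; rewrite lee_fin le_max lexx orbT.
  by apply/measurable_EFinP; apply: measurable_maxr => //; exact: measurable_cst.
have G_id y : 0 <= y -> G y = y%:E by move=> y0; rewrite /G max_l.
have -> : (\int[lambda01]_t (A t)%:E = total_jump_op lambda01 g s0 n G 0)%E.
  rewrite total_jump_opE; under eq_integral do rewrite -sumEFin.
  rewrite ge0_integral_sum//.
  - apply: eq_bigr => i _; apply: eq_integral => t _.
    by rewrite /jump_kernel /large_part/=; case: ifP => // _; rewrite add0r G_id.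
  - move=> i; apply/measurable_EFinP.
    exact: (measurableT_comp (measurable_large_part _) (mg i)).
  - by move=> i t _; rewrite lee_fin large_part_ge0.
apply: (le_trans (total_jump_le_conv n mg 0 nG)); rewrite conv_opE//.
apply: le_trans (L1_le_ss sX Xh).
rewrite le_eqVlt; apply/orP; left; apply/eqP; apply: eq_integral => t _.
by rewrite add0r G_id// ger0_norm.
Qed.

Definition small_part (y : R) : R := if s0 < `|y| then 0 else y.

Lemma measurable_small_part : measurable_fun setT small_part.
Proof.
apply: measurable_fun_ifT => //; apply: measurable_fun_ltr; first exact: measurable_cst.
by have : measurable_fun setT (fun y : R => `|id y|) by apply: measurableT_comp.
Qed.

Lemma small_part_le y : `|small_part y| <= s0.
Proof. by rewrite /small_part; case: ltP => // _; rewrite normr0. Qed.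

Lemma small_part_dist y : `|y - small_part y| = large_part s0 y.
Proof.
by rewrite /small_part /large_part; case: ifP => _; rewrite ?subr0// subrr normr0.
Qed.

Let b k (t : R) : R := small_part (g k t).
Let mb k : measurable_fun setT (b k).
Proof. exact: (measurableT_comp measurable_small_part (mg k)). Qed.

Definition small_max : R -> R := maxpsum b n.
Let V := small_max.

Lemma measurable_small_max : measurable_fun setT V.
Proof. exact: (measurable_maxpsum n mb). Qed.

Lemma psum_dist k t : (k <= n)%N -> `|psum g k t - psum b k t| <= A t.
Proof.
move=> kn; rewrite /psum -sumrB (le_trans (ler_norm_sum _ _ _))//.
rewrite (big_ord_widen n (fun i => `|g i t - b i t|))// big_mkcond/=.
apply: ler_sum => i _; case: ifP => _; last exact: large_part_ge0.
by rewrite small_part_dist.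
Qed.

Lemma maxpsum_le_large_small t : U t <= A t + V t.
Proof.
apply: maxpsum_le => [|k kn]; first by rewrite addr_ge0 ?large_sum_ge0 ?maxpsum_ge0.
rewrite -(subrK (psum b k t) (psum g k t)) (le_trans (ler_normD _ _))//.
by rewrite lerD ?psum_dist// psum_le_maxpsum.
Qed.

Lemma small_le_maxpsum_large t : V t <= U t + A t.
Proof.
apply: maxpsum_le => [|k kn]; first by rewrite addr_ge0 ?large_sum_ge0 ?maxpsum_ge0.
rewrite -(subrK (psum g k t) (psum b k t)) (le_trans (ler_normD _ _))//.
by rewrite addrC lerD ?psum_le_maxpsum// distrC psum_dist.
Qed.

(** Integrate V <= U + A. *)
Lemma small_max_L1 : (\int[lambda01]_t (V t)%:E <= D%:E)%E.
Proof.
have [U1 _] := L1_norm_le sX (ss_maxpsum n sX Xg) mU.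
have mA := measurable_large_sum; have mV := measurable_small_max.
apply: (@le_trans _ _ (\int[lambda01]_t ((U t)%:E + (A t)%:E))%E).
  apply: ge0_le_integral => //.
  - by move=> t _; rewrite lee_fin maxpsum_ge0.
  - exact/measurable_EFinP.
  - by apply: emeasurable_funD; exact/measurable_EFinP.
  - by move=> t _; rewrite -EFinD lee_fin small_le_maxpsum_large.
rewrite ge0_integralD//; last 4 first.
- by move=> t _; rewrite lee_fin maxpsum_ge0.
- exact/measurable_EFinP.
- by move=> t _; rewrite lee_fin large_sum_ge0.
- exact/measurable_EFinP.
have -> : (\int[lambda01]_t (U t)%:E = (fs_norm (Lp_fspace 1%E) U)%:E)%E.
  by rewrite -U1; apply: eq_integral => t _; rewrite ger0_norm// maxpsum_ge0.
apply: (le_trans (leeD2l _ large_sum_L1)).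
by rewrite -EFinD lee_fin addrC.
Qed.

Lemma level_le_D : s0 <= D.
Proof.
have [Xc nc] := ss_cstZ sX s0_ge0.
have mc : measurable_fun setT (cst s0 : R -> R) by exact: measurable_cst.
have [|_ H] := ss_le01 sX Xh mc.
  move=> t /andP[t0 t1] /=; rewrite !ger0_norm//.
  by apply: (level_le_head n mg t0); exact: ltW.
by rewrite nc in H; exact: le_trans hleD.
Qed.

Let e k : R := fine (\int[lambda01]_t (b k t)%:E).

Lemma b_integrable k : lambda01.-integrable setT (EFin \o b k).
Proof. exact: (bounded_integrable lambda01 (mb k) (fun t => small_part_le _)). Qed.

Let eE k : (\int[lambda01]_t (b k t)%:E = (e k)%:E)%E.
Proof. by rewrite fineK//; exact: (integrable_fin_num _ (b_integrable k)). Qed.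

Let e_le k : `|e k| <= s0.
Proof.
rewrite -lee_fin -(expectation_cst lambda01 s0).
apply: (@le_trans _ _ (\int[lambda01]_t `|(b k t)%:E|)%E).
  rewrite -[leLHS]/(`|(e k)%:E|%E) -eE; apply: le_abse_integral => //.
  by apply/measurable_EFinP; exact: mb.
apply: ge0_le_integral => //.
- by apply/measurable_EFinP; apply: measurableT_comp => //; exact: mb.
- by move=> t _; rewrite lee_fin small_part_le.
Qed.

Lemma sum_mean_le k : (k <= n)%N -> `|\sum_(i < k) e i| <= D.
Proof.
move=> kn; rewrite -lee_fin; apply: le_trans small_max_L1.
have -> : (`|\sum_(i < k) e i|%:E = `|\int[lambda01]_t (psum b k t)%:E|)%E.
  rewrite (_ : (\int[lambda01]_t (psum b k t)%:E = (\sum_(i < k) e i)%:E)%E)//.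
  under eq_integral do rewrite -sumEFin.
  rewrite integral_sum//; last by move=> i; exact: b_integrable.
  by rewrite -sumEFin; apply: eq_bigr => i _; rewrite eE.
apply: (@le_trans _ _ (\int[lambda01]_t `|(psum b k t)%:E|)%E).
  by apply: le_abse_integral => //; apply/measurable_EFinP; exact: (measurable_psum mb).
apply: ge0_le_integral => //.
- apply/measurable_EFinP; apply: measurableT_comp => //; exact: (measurable_psum mb).
- by apply/measurable_EFinP; exact: measurable_small_max.
- by move=> t _; rewrite lee_fin psum_le_maxpsum.
Qed.

Let c k (t : R) : R := b k t - e k.
Let mc k : measurable_fun setT (c k).
Proof. by apply: measurable_funB; [exact: mb|exact: measurable_cst]. Qed.

Let c_le k t : `|c k t| <= 2 * s0.
Proof.
rewrite (le_trans (ler_normB _ _))// mulr_natl mulr2n lerD ?small_part_le//.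
Qed.

Let c_mean k : (\int[lambda01]_t (c k t)%:E = 0)%E.
Proof.
rewrite /c; under eq_integral do rewrite EFinB.
rewrite integralB_EFin//; last 2 first.
- exact: b_integrable.
- by apply: (@bounded_integrable _ _ _ lambda01 (cst (e k)) `|e k|) => //; exact: measurable_cst.
by rewrite eE expectation_cst subee.
Qed.

Let c_var k : (\int[lambda01]_t (c k t ^+ 2)%:E =
   (fine (\int[lambda01]_t (c k t ^+ 2)%:E))%:E)%E.
Proof.
have m2 : measurable_fun setT (fun t => c k t ^+ 2) by exact: measurable_funX.
rewrite fineK//; apply: (integrable_fin_num measurableT).
apply: (@bounded_integrable _ _ _ lambda01 (fun t => c k t ^+ 2) ((2 * s0) ^+ 2)) => // t.
by rewrite normrX lerXn2r ?nnegrE// (le_trans _ (c_le k t)).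
Qed.

Let ic : indep_seq lambda01 c.
Proof.
apply: (@indep_seq_comp R _ _ lambda01 g (fun k y => small_part y - e k) ig) => k.
by apply: measurable_funB; [exact: measurable_small_part|exact: measurable_cst].
Qed.

Let psum_c k t : psum c k t = psum b k t - \sum_(i < k) e i.
Proof. by rewrite /psum -sumrB. Qed.

Lemma psum_c_L1 : (\int[lambda01]_t (`|psum c n t|)%:E <= (2 * D)%:E)%E.
Proof.
have mV := measurable_small_max.
apply: (@le_trans _ _ (\int[lambda01]_t ((V t)%:E + D%:E))%E).
  apply: ge0_le_integral => //.
  - by apply/measurable_EFinP; apply: measurableT_comp => //; exact: (measurable_psum mc).
  - by apply: emeasurable_funD => //; exact/measurable_EFinP.
  - move=> t _; rewrite -EFinD lee_fin psum_c (le_trans (ler_normB _ _))//.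
    by rewrite lerD ?psum_le_maxpsum// sum_mean_le.
rewrite ge0_integralD//; last 3 first.
- by move=> t _; rewrite lee_fin maxpsum_ge0.
- exact/measurable_EFinP.
- by move=> t _; rewrite lee_fin ltW.
rewrite expectation_cst mulr_natl mulr2n EFinD; apply: leeD => //.
exact: small_max_L1.
Qed.

Let A0 := tail_constant R.
Let A0_gt0 : 0 < A0. Proof. exact: tail_constant_gt0. Qed.
Let kap := kruglov_rearr P B (cst (1 : R)).
Let kap0 t : 0 <= kap t. Proof. exact: rearr_ge0. Qed.
Let m1 : measurable_fun setT (cst 1 : R -> R). Proof. exact: measurable_cst. Qed.
Let mkap : measurable_fun setT kap. Proof. exact: (measurable_kruglov_rearr P hB m1). Qed.

(** The constant part leaves room for the means of the small parts, at most D
    in total, and for rounding levels to multiples of A0 D. *)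
Definition majorant (t : R) : R := D * (1 + A0) + D * A0 * kap t.

Lemma measurable_majorant : measurable_fun setT majorant.
Proof.
apply: measurable_funD; first exact: measurable_cst.
by apply: measurable_funM; [exact: measurable_cst|exact: mkap].
Qed.

(** Above the constant part, an excess s of V makes the centred sums exceed A0
    j D for j the integer part of (s / D - 1) / A0. The maximal inequality
    bounds the probability by the measure 1 / (e j!) of the event where K 1 =
    j, on which the majorant exceeds s as well. *)
Lemma dfun_small_max s : 0 <= s -> (dfun lambda01 V s <= dfun lambda01 majorant s)%E.
Proof.
move=> s_ge0; have mV := measurable_small_max.
have w_ge t : D * (1 + A0) <= majorant t.
  by rewrite lerDl (mulr_ge0 (mulr_ge0 (ltW D0) (ltW A0_gt0)) (kap0 t)).
have DA0 : 0 < D * (1 + A0) := mulr_gt0 D0 (addr_gt0 ltr01 A0_gt0).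
have [sD|sD] := ltP s (D * (1 + A0)).
  apply: (le_trans (dfun01_le1 s mV)).
  rewrite -(probability_setT (@lambda01 R)) /dfun (_ : [set x | _] = setT)//.
  apply/seteqP; split => // t _ /=; rewrite (lt_le_trans sD)// (le_trans (w_ge t))//.
  exact: ler_norm.
(* The level index will be the integer part of x, positive because x >= 1. *)
pose x := (s / D - 1) / A0.
have xE : s = D * (1 + A0 * x).
  by rewrite /x; field; rewrite !gt_eqF.
have x1 : 1 <= x.
  by rewrite /x ler_pdivlMr// mul1r lerBrDr ler_pdivlMr// mulrC addrC.
have x0 : 0 <= x by exact: le_trans x1.
pose j := Num.truncn x.
have /andP[jx xj] : j%:R <= x < j.+1%:R by exact: truncn_itv.
have j0 : (0 < j)%N by rewrite truncn_gt0.
apply: (@le_trans _ _ ((expR 1 * j`!%:R)^-1)%:E).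
  have cD : 2 * s0 <= 2 * D by rewrite ler_wpM2l// level_le_D.
  have MT := @maximal_tail _ _ R (@lambda01 R) c _ _ mc ic c_le c_mean c_var n D j D0 cD psum_c_L1 j0.
  apply: (le_trans _ MT).
  apply: le_measure; rewrite ?inE.
  - exact: measurable_superlevel.
  - exact: (measurable_exceeds mc).
  - move=> t /=; rewrite ger0_norm ?maxpsum_ge0// => sV; apply: contrapT => H.
    move: sV; rewrite ltNge => /negP; apply; apply: maxpsum_le => // k kn.
    rewrite leNgt; apply/negP => sb; apply: H; exists k => //.
    have Dk := sum_mean_le kn.
    have := lerB_dist (psum b k t) (\sum_(i < k) e i); rewrite -psum_c => Hd.
    apply: lt_le_trans Hd; rewrite -/A0.
    have : A0 * j%:R * D <= A0 * x * D by rewrite ler_wpM2r ?(ltW D0)// ler_wpM2l// ltW.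
    have : s = D + A0 * x * D by rewrite xE; ring.
    lra.
have xj1 : x - 1 < j%:R by rewrite ltrBlDr natr1.
apply: (le_trans (kruglov_one_tail hP hB j0 xj1)).
have x10 : 0 <= x - 1 by rewrite subr_ge0.
rewrite -(dfun_kruglov_rearr P hB m1 x10).
apply: le_measure; rewrite ?inE; try exact: measurable_superlevel.
  by apply: measurable_superlevel; exact: measurable_majorant.
move=> t /=; rewrite -/kap (ger0_norm (kap0 t)) => xk.
rewrite ger0_norm; last by rewrite (le_trans (ltW DA0))// w_ge.
rewrite /majorant xE (_ : D * (1 + A0 * x) = D * (1 + A0) + D * A0 * (x - 1)); last by ring.
by rewrite ltrD2l ltr_pM2l// mulr_gt0.
Qed.

Lemma ss_small_max : X V /\ fs_norm X V <= (4 + 5 * A0) * K * D.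
Proof.
have [Xk nk] := kruglov_one hB sX KX.
have K4 := kruglov_opnorm_ge hP hB sX KX.
have DA0 : 0 <= D * (1 + A0) := mulr_ge0 (ltW D0) (addr_ge0 ler01 (ltW A0_gt0)).
have [Xc nc] := ss_cstZ sX DA0.
have Xw : X majorant by apply: (bfs_D bX Xc); exact: (bfs_Z bX (D * A0) Xk).
have nw : fs_norm X majorant <= D * (1 + A0) + D * A0 * K.
  apply: (le_trans (bfs_normD bX Xc (bfs_Z bX (D * A0) Xk))).
  have DA : 0 <= D * A0 := mulr_ge0 (ltW D0) (ltW A0_gt0).
  by rewrite nc lerD2l (bfs_normZ bX)// ger0_norm// ler_wpM2l.
have [XV nV] := ss_dom sX Xw measurable_small_max dfun_small_max.
split => //; apply: (le_trans nV); apply: (le_trans nw).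
have H : D * (1 + A0) * 1 <= D * (1 + A0) * (4 * K) by rewrite ler_wpM2l.
have -> : (4 + 5 * A0) * K * D = D * (1 + A0) * (4 * K) + D * A0 * K by ring.
by rewrite lerD2r -[leLHS]mulr1.
Qed.

Lemma upper_estimate : fs_norm X U <= (8 + 5 * A0) * K * D.
Proof.
have [XA nA] := ss_large_sum; have [XV nV] := ss_small_max.
have [_ H] : X U /\ fs_norm X U <= fs_norm X (A \+ V).
  apply: (ss_le sX (bfs_D bX XA XV) mU) => t /=.
  rewrite !ger0_norm ?maxpsum_ge0 ?addr_ge0 ?large_sum_ge0 ?maxpsum_ge0//.
  exact: maxpsum_le_large_small.
apply: (le_trans H); apply: (le_trans (bfs_normD bX XA XV)).
rewrite (_ : (8 + 5 * A0) * K * D = 4 * (K * D) + (4 + 5 * A0) * K * D); last by ring.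
exact: lerD.
Qed.

End upper_estimate.

(** * Finite families and the theorem *)

Section finite_families.
Context (R : realType) (n : nat) (f : 'I_n -> R -> R).

(** Padding by 0 provides the infinite sequence that drives chains. *)
Definition extend (k : nat) : R -> R :=
  if insub k is Some i then f i else cst 0.

Lemma extendE : (fun i : 'I_n => extend i) = f.
Proof. by apply/funext => i; rewrite /extend valK. Qed.

Lemma extend_ord (i : 'I_n) : extend i = f i.
Proof. by rewrite -[f in RHS]extendE. Qed.

Lemma extend_off k : (n <= k)%N -> extend k = cst 0.
Proof. by move=> nk; rewrite /extend insubN// -leqNgt. Qed.

(** A padding constant contributes an event of probability 0 or 1. *)
Lemma indep_seq_extend : independent_rvs lambda01 f -> indep_seq lambda01 extend.
Proof.
move=> indf m A mA.
have [/existsP[/= k /andP[nk kA]]|/existsPn/= H] :=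
    boolP [exists k : 'I_m, (n <= k)%N && `[< ~ A k 0 >]].
  have Ek : extend k @^-1` A k = set0.
    rewrite extend_off//; apply/seteqP; split => // t /=; exact/asboolP.
  have -> : [set w | forall k, (k < m)%N -> A k (extend k w)] = set0.
    apply/seteqP; split => // t /= /(_ k (ltn_ord k)) Ak.
    by have : (extend k @^-1` A k) t by []; rewrite Ek.
  rewrite measure0; apply/esym.
  by rewrite (bigD1 k)//= [X in lambda01 X]Ek measure0 mul0e.
have A0 k : (n <= k)%N -> (k < m)%N -> A k 0.
  move=> nk km; have := H (Ordinal km); rewrite nk/= => /asboolPn; exact: contrapT.
pose A' (k : nat) := if (k < m)%N then A k else setT.
have mA' k : measurable (A' k) by rewrite /A'; case: ifP.
have -> : [set w | forall k, (k < m)%N -> A k (extend k w)] =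
    \bigcap_(i : 'I_n) (f i @^-1` A' i).
  apply/seteqP; split => t /= Ht.
    by move=> i _; rewrite /= /A' -extend_ord; case: ifP => // im; exact: Ht.
  move=> k km; have [nk|kn] := leqP n k; first by rewrite extend_off//=; exact: A0.
  by have := Ht (Ordinal kn) I; rewrite /= /A' km -extend_ord.
apply: (etrans (indf (fun i => A' i) (fun i => mA' i))).
rewrite (eq_bigr (fun i : 'I_n => lambda01 (extend i @^-1` A' i))); last first.
  by move=> i _; rewrite extend_ord.
rewrite (big_ord_widen (m + n) (fun k => lambda01 (extend k @^-1` A' k)) (leq_addl m n)).
rewrite (big_ord_widen (m + n) (fun k => lambda01 (extend k @^-1` A k)) (leq_addr n m)).
rewrite big_mkcond [RHS]big_mkcond/=; apply: eq_bigr => k _; rewrite /A'.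
have [km|mk] := ltnP k m; have [kn|nk] := ltnP k n => //.
- rewrite extend_off// (_ : _ @^-1` _ = setT); first exact/esym/probability_setT.
  by apply/seteqP; split => // t _; exact: A0.
- by rewrite preimage_setT; exact: probability_setT.
Qed.

End finite_families.

Theorem theorem18 (R : realType) :
  exists alpha : R, 0 < alpha /\
  forall (P : probability (Omega R) R) (B : nat -> set R) (X : fspace R),
    is_product_measure P -> kruglov_partition B ->
    symmetric_space X ->
    interpolation_space (Lp_fspace 1%E) (Lp_fspace +oo%E) X ->
    kruglov_bounded P B X ->
    forall (n : nat) (f : 'I_n -> R -> R), (0 < n)%N ->
      (forall k, X (f k)) ->
      independent_rvs lambda01 f ->
      let M := fs_norm X (rearr_head f)
               + fs_norm (Lp_fspace 1%E) (max_partial_sum f) in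
      5^-1 * M <= fs_norm X (max_partial_sum f) /\
      fs_norm X (max_partial_sum f) <= alpha * kruglov_opnorm P B X * M.
Proof.
(* In units of the operator norm times D, with A0 the tail constant: 4 for the
   large values, 4 (1 + A0) + A0 for the small ones. *)
pose alpha : R := 8 + 5 * tail_constant R.
have alpha0 : 0 < alpha by rewrite addr_gt0// mulr_gt0// tail_constant_gt0.
exists alpha; split => // P B X hP hB sX _ KX n f n0 Xf indf.
have bX := ss_banach sX.
have Xg k : X (extend f k).
  by rewrite /extend; case: insubP => [i _ _|_]; [exact: Xf|exact: bfs_0].
have ig := indep_seq_extend indf.
rewrite -(extendE f) max_partial_sumE => M.
split; first exact: (lower_estimate n sX Xg ig).
have K0 : 0 < kruglov_opnorm P B X by have := kruglov_opnorm_ge hP hB sX KX; lra.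
have aK0 : 0 < alpha * kruglov_opnorm P B X by rewrite mulr_gt0.
have M0 : 0 <= M.
  rewrite addr_ge0 ?fine_ge0 ?Lnorm_ge0//.
  exact: (bfs_norm_ge0 bX (rearr_head_le n sX Xg ig).1).
(* M may vanish, whereas the upper estimate is for a positive bound D of M. *)
apply/ler_addgt0Pr => e e0.
set d := e / (alpha * kruglov_opnorm P B X).
have d0 : 0 < d by rewrite divr_gt0.
have -> : alpha * kruglov_opnorm P B X * M + e = alpha * kruglov_opnorm P B X * (M + d).
  by rewrite [RHS](mulrDr _ M d) [X in _ = _ + X]mulrC divfK// gt_eqF.
apply: (upper_estimate hP hB sX KX Xg ig).
- by rewrite ltr_wpDl.
- by rewrite lerDl ltW.
Qed.
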